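(* Let $s\ge 2$, let $A$ be an $s\times s$ matrix with entries in $\{0,1\}$ which is irreducible and aperiodic, and let $\theta>1$. Let $m$ denote the Parry measure. Then there exists a constant $c>0$ such that for any $\sigma$-invariant Borel probability measure $\mu$ on the one-sided subshift $\Sigma_A^+$ and any Lipschitz function $f:\Sigma_A^+\to\mathbb{R}$ (with respect to $d_\theta$) we have $$\left|\int f\, d\mu-\int f\, dm\right| \le c\, |f|_\theta\, \bigl(h_m(\sigma)-h_\mu(\sigma)\bigr)^{1/2}.$$ Moreover, the same result holds for the two-sided subshift of finite type $(\Sigma_A,\sigma)$: there exists a constant $c>0$ such that the same inequality holds for any $\sigma$-invariant Borel probability measure $\mu$ on $\Sigma_A$ and any Lipschitz function $f:\Sigma_A\to\mathbb{R}$.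
   Context: Let $\Lambda=\{1,\dots,s\}$. The two-sided subshift is $\Sigma_A=\{x=(x_n)_{n\in\mathbb{Z}}\in\Lambda^{\mathbb{Z}}: A(x_n,x_{n+1})=1\ \forall n\in\mathbb{Z}\}$ and the one-sided subshift is $\Sigma_A^+=\{x=(x_n)_{n\ge 0}\in\Lambda^{\mathbb{N}}: A(x_n,x_{n+1})=1\ \forall n\ge 0\}$, both with the product topology; $\sigma$ is the shift, $(\sigma x)_n=x_{n+1}$. Irreducible: for each pair $(i,j)$ there is $n\ge1$ with $A^n(i,j)>0$. Aperiodic (in this paper): $A(i,i)=1$ for all $i$. Metric: $d_\theta(x,y)=\theta^{-t(x,y)}$ (and $d_\theta(x,x)=0$), where $t(x,y)=\max\{n\ge0: x_i=y_i \text{ for } |i|<n\}$ on $\Sigma_A$, and $t(x,y)=\max\{n\ge0: x_i=y_i \text{ for } 0\le i<n\}$ on $\Sigma_A^+$. Seminorm: for continuous $g$ on $\Sigma_A^+$ and $n\ge0$ let $\mathrm{var}_n g=\sup\{|g(x)-g(y)|: x_i=y_i,\ 0\le i<n\}$; on $\Sigma_A$ use the condition $|i|<n$ instead of $0\le i<n$. For Lipschitz $g$, $|g|_\theta=\sup\{\theta^n\,\mathrm{var}_n g: n\ge0\}$, which is the least Lipschitz constant of $g$ with respect to $d_\theta$. Parry measure: let $\lambda>1$ be the largest eigenvalue of $A$, and let $(u_i)_{i\in\Lambda}$, $(v_i)_{i\in\Lambda}$ be strictly positive left and right eigenvectors of $A$ for $\lambda$ with $\sum_i u_iv_i=1$.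 Then $m$ is the $\sigma$-invariant Markov measure (on $\Sigma_A$ or $\Sigma_A^+$) given by the probability vector $p_i=u_iv_i$ and the stochastic matrix $p_{ij}=A(i,j)v_j/(\lambda v_i)$. It is the unique measure of maximal entropy. $h_\mu(\sigma)$ denotes the Kolmogorov–Sinai entropy of $\sigma$ with respect to $\mu$. *)

(* Defs.v *)
From HB Require Import structures.
From mathcomp Require Import all_boot all_order all_algebra.
From mathcomp Require Import all_classical all_reals all_analysis.

Set Implicit Arguments.
Unset Strict Implicit.
Unset Printing Implicit Defensive.

Import Order.TTheory GRing.Theory Num.Theory.
Import numFieldNormedType.Exports.

Local Open Scope classical_set_scope.
Local Open Scope ring_scope.

Section matrices.
Context {R : realType} {s : nat}.
Implicit Types A : 'M[R]_s.

Definition zero_one_mx A := forall i j, A i j = 0 \/ A i j = 1.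

Definition irreducible_mx A :=
  forall i j, exists n : nat, (1 <= n)%N /\ 0 < (A ^+ n) i j.

(* Not the usual gcd-of-periods condition: every state has a self-loop. *)
Definition aperiodic_mx A := forall i, A i i = 1.

Record perron_data A (lam : R) (u : 'rV[R]_s) (v : 'cV[R]_s) : Prop :=
  PerronData {
    perron_gt1 : 1 < lam ;
    perron_eigenvalue : eigenvalue A lam ;
    perron_largest : forall a, eigenvalue A a -> a <= lam ;
    perron_left_gt0 : forall i, 0 < u 0 i ;
    perron_right_gt0 : forall i, 0 < v i 0 ;
    perron_left : u *m A = lam *: u ;
    perron_right : A *m v = lam *: v ;
    perron_normalized : \sum_i u 0 i * v i 0 = 1 }.

Definition parry_vector (u : 'rV[R]_s) (v : 'cV[R]_s) (i : 'I_s) : R :=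
  u 0 i * v i 0.

Definition parry_matrix A (lam : R) (v : 'cV[R]_s) (i j : 'I_s) : R :=
  A i j * v j 0 / (lam * v i 0).

End matrices.

(* The one-sided and the two-sided shift differ only in the index set of the
   sequences, its successor map, and the window of indices on which two points
   must agree to be n-close. *)
Record time := Time {
  time_index : countType ;
  succ_index : time_index -> time_index ;
  window : nat -> set time_index }.

Definition one_sided : time :=
  @Time nat (fun n => n.+1) (fun n => [set i | (i < n)%N]).

Definition two_sided : time :=
  @Time int (fun n => n + 1) (fun n => [set i | (`|i| < n)%N]).

Definition full_shift (s : nat) (tm : time) : Type :=
  prod_topology (fun _ : time_index tm => discrete_topology 'I_s).

HB.instance Definition _ (s : nat) (tm : time) :=
  Topological.copy (full_shift s tm)
    (prod_topology (fun _ : time_index tm => discrete_topology 'I_s)).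

Definition admissible (R : realType) (s : nat) (tm : time) (A : 'M[R]_s) :
    set (full_shift s tm) :=
  [set x : full_shift s tm | forall n, A (x n) (x (succ_index n)) = 1].
Arguments admissible {R s} tm A.

(* The hypotheses hs and hA are arguments of the type because the library
   requires measurable spaces to be inhabited: the point is a constant
   sequence. *)
Definition subshift (R : realType) (s : nat) (tm : time) (A : 'M[R]_s)
    (hs : (2 <= s)%N) (hA : aperiodic_mx A) : Type :=
  set_type (admissible tm A).
Arguments subshift {R s} tm {A} hs hA.

Section subshift.
Context {R : realType} {s : nat} {tm : time} {A : 'M[R]_s}.
Context {hs : (2 <= s)%N} {hA : aperiodic_mx A}.
Local Notation X := (subshift tm hs hA).

Lemma constant_admissible :
  ((fun=> Ordinal (ltnW hs)) : full_shift s tm) \in admissible tm A.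
Proof. by rewrite inE => n; exact: hA. Qed.

HB.instance Definition _ := Topological.copy X (set_type (admissible tm A)).
HB.instance Definition _ := isPointed.Build X
  (exist (fun x => x \in admissible tm A) _ constant_admissible).
HB.instance Definition _ :=
  Measurable.copy X (g_sigma_algebraType (@open X)).

Definition letter (x : X) (n : time_index tm) : 'I_s := (sval x) n.

Lemma shift_admissible (x : X) :
  ((fun n => letter x (succ_index n)) : full_shift s tm) \in admissible tm A.
Proof.
by rewrite inE => n /=; move: (svalP x); rewrite inE => /(_ (succ_index n)).
Qed.

Definition shift_map (x : X) : X :=
  exist (fun x => x \in admissible tm A) _ (shift_admissible x).

Definition agree (n : nat) (x y : X) : Prop :=
  forall i : time_index tm, window n i -> letter x i = letter y i.

(* The maximum exists whenever x <> y. *)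
Definition agreement (x y : X) : nat :=
  xget 0%N [set n | agree n x y /\ forall k, agree k x y -> (k <= n)%N].

Definition shift_dist (theta : R) (x y : X) : R :=
  if x == y then 0 else theta ^- agreement x y.

Definition lipschitz_fun (theta : R) (f : X -> R) : Prop :=
  exists L : R, forall x y, `|f x - f y| <= L * shift_dist theta x y.

Definition var_n (n : nat) (f : X -> R) : R :=
  sup [set r | exists x y, agree n x y /\ r = `|f x - f y|].

Definition lip_seminorm (theta : R) (f : X -> R) : R :=
  sup [set theta ^+ n * var_n n f | n in [set: nat]].

Definition cylinder (a : time_index tm) (n : nat) (w : nat -> 'I_s) : set X :=
  [set x | forall k, (k <= n)%N -> letter x (iter k (@succ_index tm) a) = w k].

(* Stationary Markov measure: the cylinder probabilities do not depend on the
   starting index a. *)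
Definition markov_measure (p : 'I_s -> R) (P : 'I_s -> 'I_s -> R)
    (m : probability X R) : Prop :=
  forall (a : time_index tm) (n : nat) (w : nat -> 'I_s),
    m (cylinder a n w) = (p (w 0%N) * \prod_(k < n) P (w k) (w k.+1))%:E.

Definition parry_measure (lam : R) (u : 'rV[R]_s) (v : 'cV[R]_s)
    (m : probability X R) : Prop :=
  markov_measure (parry_vector u v) (parry_matrix A lam v) m.

End subshift.

Section entropy.
Context d (T : measurableType d) (R : realType).
Variables (S : T -> T) (mu : probability T R).

Definition invariant_measure : Prop :=
  forall B : set T, measurable B -> mu (S @^-1` B) = mu B.

(* A finite partition is encoded by its labelling map xi : T -> J; the atoms
   are the fibres of xi. *)
Definition measurable_partition (J : finType) (xi : T -> J) : Prop :=
  forall j, measurable (xi @^-1` [set j]).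

(* ln 0 = 0, whence 0 ln 0 = 0. *)
Definition partition_entropy (J : finType) (xi : T -> J) : R :=
  - \sum_(j : J) fine (mu (xi @^-1` [set j])) *
                 ln (fine (mu (xi @^-1` [set j]))).

(* Labelling of the join of xi, S^-1 xi, ..., S^-(n-1) xi. *)
Definition join_partition (J : finType) (xi : T -> J) (n : nat) (x : T) :
    {ffun 'I_n -> J} :=
  [ffun i : 'I_n => xi (iter i S x)].

Definition entropy_of_partition (J : finType) (xi : T -> J) : R :=
  lim ((fun n : nat => partition_entropy (join_partition xi n) / n%:R) @ \oo).

Definition KS_entropy : \bar R :=
  ereal_sup [set h | exists (k : nat) (xi : T -> 'I_k),
    measurable_partition xi /\ h = (entropy_of_partition xi)%:E].

End entropy.

(* Main.v *)
(** Fix the Parry chain with backward transition probabilities q(i | j) and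
    transfer operator L g(w) = sum_i q(i | w_0) g(i w), acting on functions of
    finitely many letters. If a function G and a real t are such that
    t (G(i w) - L G(w)) is at most 1/2 in absolute value, then
    q(i | w_0) (1 + t (G(i w) - L G(w))) is a conditional probability on
    prefixed letters. Coding the itineraries of an invariant measure mu with it
    (Gibbs' inequality) and optimizing over t gives
      h_mu <= ln lam - (int (G - L G) dmu)^2 / (32 |G|^2).
    An arbitrary measurable partition is handled by the same code, completed by
    a cheap description of the partition given the itinerary. A function g of
    k+1 letters satisfies a Poisson equation G - L G = g - int g dm with
    |G| = O((k + 1) |g|): one-letter functions are treated by linear algebra,
    and prepending letters by induction. A Lipschitz function is a telescoping
    series of functions of O(n) letters whose n-th term is at most
    |f|_theta theta^-n, so the corresponding G is bounded by a constant
    multiple of |f|_theta. *)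
Require Import Defs.
From mathcomp Require Import all_boot all_order all_algebra.
From mathcomp Require Import all_classical all_reals all_analysis.
From mathcomp Require Import measurable_realfun zify ring lra.
Import Order.TTheory GRing.Theory Num.Theory.
Import numFieldNormedType.Exports.
Local Open Scope classical_set_scope.
Local Open Scope ring_scope.

Set Implicit Arguments.
Unset Strict Implicit.
Unset Printing Implicit Defensive.

(** * Expectations of bounded measurable functions *)

Section bounded_measurable.
Context d (T : measurableType d) (R : realType) (mu : probability T R).
Implicit Types f g : T -> R.

Definition bounded_measurable f :=
  measurable_fun setT f /\ exists M, forall x, `|f x| <= M.

Lemma bounded_measurable_integrable f :
  bounded_measurable f -> mu.-integrable setT (EFin \o f).
Proof.
move=> [mf [M fM]]; apply: measurable_bounded_integrable => //.
  by rewrite [X in (X < _)%E](probability_setT mu) ltry.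
exists M; split; first by rewrite num_real.
by move=> r Mr x _ /=; exact: le_trans (fM x) (ltW Mr).
Qed.
Local Hint Resolve bounded_measurable_integrable : core.

Lemma bounded_measurable_cst r : bounded_measurable (fun=> r).
Proof. by split; [exact: measurable_cst | exists `|r|]. Qed.

Lemma bounded_measurableD f g : bounded_measurable f -> bounded_measurable g ->
  bounded_measurable (fun x => f x + g x).
Proof.
move=> [mf [M fM]] [mg [N gN]]; split; first exact: measurable_funD.
by exists (M + N) => x; rewrite (le_trans (ler_normD _ _))// lerD.
Qed.

Lemma bounded_measurableZ r f : bounded_measurable f ->
  bounded_measurable (fun x => r * f x).
Proof.
move=> [mf [M fM]]; split; first exact: measurable_funM.
by exists (`|r| * M) => x; rewrite normrM ler_wpM2l.
Qed.

Lemma bounded_measurableB f g : bounded_measurable f -> bounded_measurable g ->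
  bounded_measurable (fun x => f x - g x).
Proof.
move=> bf /(bounded_measurableZ (-1)) /(bounded_measurableD bf).
by congr bounded_measurable; apply/funext => x; rewrite mulN1r.
Qed.

Lemma bounded_measurable_sum (I : Type) (r : seq I) (f : I -> T -> R) :
  (forall i, bounded_measurable (f i)) ->
  bounded_measurable (fun x => \sum_(i <- r) f i x).
Proof.
move=> bf; elim: r => [|i r IH].
  under eq_fun do rewrite big_nil; exact: bounded_measurable_cst.
under eq_fun do rewrite big_cons; exact: bounded_measurableD.
Qed.

Lemma expectation_cst r : \int[mu]_x r = r :> R.
Proof. by rewrite Rintegral_cst// [X in fine X](probability_setT mu) mulr1. Qed.

Lemma expectationD f g : bounded_measurable f -> bounded_measurable g ->
  \int[mu]_x (f x + g x) = \int[mu]_x f x + \int[mu]_x g x.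
Proof. by move=> bf bg; rewrite RintegralD//; auto. Qed.

Lemma expectationB f g : bounded_measurable f -> bounded_measurable g ->
  \int[mu]_x (f x - g x) = \int[mu]_x f x - \int[mu]_x g x.
Proof. by move=> bf bg; rewrite RintegralB//; auto. Qed.

Lemma expectationZ r f : bounded_measurable f ->
  \int[mu]_x (r * f x) = r * \int[mu]_x f x.
Proof. by move=> bf; rewrite RintegralZl//; auto. Qed.

Lemma expectation_sum (I : Type) (r : seq I) (f : I -> T -> R) :
  (forall i, bounded_measurable (f i)) ->
  \int[mu]_x (\sum_(i <- r) f i x) = \sum_(i <- r) \int[mu]_x f i x.
Proof.
move=> bf; elim: r => [|i r IH].
  by rewrite big_nil; under eq_Rintegral do rewrite big_nil; rewrite expectation_cst.
rewrite big_cons -IH -expectationD//; last exact: bounded_measurable_sum.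
by apply: eq_Rintegral => x _; rewrite big_cons.
Qed.

Lemma le_expectation f g : bounded_measurable f -> bounded_measurable g ->
  (forall x, f x <= g x) -> \int[mu]_x f x <= \int[mu]_x g x.
Proof. by move=> bf bg fg; apply: le_Rintegral; auto. Qed.

Lemma norm_expectation_le f M : bounded_measurable f ->
  (forall x, `|f x| <= M) -> `|\int[mu]_x f x| <= M.
Proof.
move=> bf fM; rewrite ler_norml -(expectation_cst (- M)) -{2}(expectation_cst M).
by apply/andP; split; (apply: le_expectation => //;
  [exact: bounded_measurable_cst | move=> x; have := fM x; rewrite ler_norml => /andP[]]).
Qed.

(** A function of a finite label is a simple function; its measurability and its integral reduce to
    indicators of atoms. *)
Lemma label_decomposition (Z : finType) (zeta : T -> Z) (phi : Z -> R) x :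
  phi (zeta x) = \sum_z phi z * \1_(zeta @^-1` [set z]) x.
Proof.
rewrite (bigD1 (zeta x))//= big1 ?addr0 => [|z zx].
  by rewrite indicE mem_set// mulr1.
by rewrite indicE memNset ?mulr0// => /= /esym/eqP; exact/negP.
Qed.

Lemma bounded_measurable_indic (B : set T) : measurable B ->
  bounded_measurable (\1_B : T -> R).
Proof.
move=> mB; split; first exact: measurable_indic.
by exists 1 => x; rewrite indicE; case: (_ \in _); rewrite ?normr1 ?normr0.
Qed.

Lemma expectation_indic (B : set T) : measurable B ->
  \int[mu]_x (\1_B x) = fine (mu B) :> R.
Proof. by move=> mB; rewrite /Rintegral integral_indic// setIT. Qed.

Section label.
Context (Z : finType) (zeta : T -> Z).
Hypothesis mzeta : measurable_partition zeta.

Lemma bounded_measurable_label (phi : Z -> R) :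
  bounded_measurable (fun x => phi (zeta x)).
Proof.
under eq_fun do rewrite label_decomposition.
apply: bounded_measurable_sum => z; apply: bounded_measurableZ.
exact: bounded_measurable_indic.
Qed.

Lemma expectation_label (phi : Z -> R) :
  \int[mu]_x phi (zeta x) = \sum_z phi z * fine (mu (zeta @^-1` [set z])).
Proof.
under eq_Rintegral do rewrite label_decomposition.
rewrite expectation_sum => [|z]; last first.
  by apply: bounded_measurableZ; exact: bounded_measurable_indic.
apply: eq_bigr => z _; rewrite expectationZ; last exact: bounded_measurable_indic.
by rewrite expectation_indic.
Qed.

Lemma sum_label_probability :
  \sum_z fine (mu (zeta @^-1` [set z])) = 1.
Proof.
have := expectation_label (fun=> 1); rewrite expectation_cst => ->.
by apply: eq_bigr => z _; rewrite mul1r.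
Qed.

Lemma measurable_label (P : set Z) : measurable (zeta @^-1` P).
Proof.
have -> : zeta @^-1` P = \bigcup_(z in P) (zeta @^-1` [set z]).
  apply/seteqP; split => [x Px|x [z Pz /= ->]//]; by exists (zeta x).
by apply: fin_bigcup_measurable => //; exact: finite_finset.
Qed.

Lemma measurable_partition_comp (Y : finType) (h : Z -> Y) :
  measurable_partition (h \o zeta).
Proof. by move=> y; rewrite comp_preimage; exact: measurable_label. Qed.

End label.

Lemma measurable_partition_pair (Y Z : finType) (eta : T -> Y) (zeta : T -> Z) :
  measurable_partition eta -> measurable_partition zeta ->
  measurable_partition (fun x => (eta x, zeta x)).
Proof.
move=> me mz [y z].
have -> : (fun x => (eta x, zeta x)) @^-1` [set (y, z)] =
    eta @^-1` [set y] `&` zeta @^-1` [set z].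
  by apply/seteqP; split => [x [<- <-]//|x [/= -> ->]].
exact: measurableI.
Qed.

Lemma measurable_partition_ffun (I J : finType) (xi : I -> T -> J) :
  (forall i, measurable_partition (xi i)) ->
  measurable_partition (fun x => [ffun i => xi i x]).
Proof.
move=> mxi w.
have -> : (fun x => [ffun i => xi i x]) @^-1` [set w] =
    \bigcap_(i in [set: I]) (xi i @^-1` [set w i]).
  apply/seteqP; split => [x /= <- i _ /=|x xw]; first by rewrite ffunE.
  by apply/ffunP => i; rewrite ffunE; exact: xw.
by apply: fin_bigcap_measurable => // i _; exact: mxi.
Qed.

End bounded_measurable.

(** * Entropy of codes *)

Section entropy.
Context d (T : measurableType d) (R : realType) (mu : probability T R).

Lemma fine_probability_ge0 (B : set T) : 0 <= fine (mu B).
Proof. exact: fine_ge0. Qed.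

Lemma label_probability_comp (Z Y : finType) (zeta : T -> Z) (h : Z -> Y) y :
  measurable_partition zeta ->
  fine (mu ((h \o zeta) @^-1` [set y])) =
  \sum_(z | h z == y) fine (mu (zeta @^-1` [set z])).
Proof.
move=> mzeta; have mh := measurable_partition_comp mzeta h.
(* Both sides are the expectation of the indicator of [h (zeta x) == y], computed once with the
   label [h \o zeta] and once with [zeta]. *)
transitivity (\int[mu]_x ((h (zeta x) == y)%:R : R)).
  rewrite (expectation_label mu mh (fun v => (v == y)%:R)) (bigD1 y)//= eqxx mul1r.
  by rewrite big1 ?addr0// => v /negPf ->; rewrite mul0r.
rewrite (expectation_label mu mzeta (fun z => (h z == y)%:R)) [RHS]big_mkcond/=.
by apply: eq_bigr => z _; case: eqP; rewrite ?mul1r ?mul0r.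
Qed.

(** Merging atoms lowers entropy: an atom of mass [p] lies in a merged atom of mass [q >= p], whence
    [p ln p <= p ln q]. *)
Lemma partition_entropy_comp (Z Y : finType) (zeta : T -> Z) (h : Z -> Y) :
  measurable_partition zeta ->
  partition_entropy mu (h \o zeta) <= partition_entropy mu zeta.
Proof.
move=> mzeta; rewrite /partition_entropy lerN2.
rewrite (partition_big h predT)//=; apply: ler_sum => y _.
rewrite label_probability_comp// mulr_suml; apply: ler_sum => z /eqP hz.
set p := fine _; have [->|p0] := eqVneq p 0; first by rewrite !mul0r.
have {}p0 : 0 < p by rewrite lt0r p0 fine_probability_ge0.
apply: ler_wpM2l; first exact: ltW.
have pS : p <= \sum_(i | h i == y) fine (mu (zeta @^-1` [set i])).
  rewrite (bigD1 z) ?hz//= lerDl sumr_ge0// => i _.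
  exact: fine_probability_ge0.
by rewrite ler_ln// posrE// (lt_le_trans p0).
Qed.

Lemma ln_le_subr1 (x : R) : 0 < x -> ln x <= x - 1.
Proof.
by move=> x0; have := @le_ln1Dx R (x - 1); rewrite addrCA subrr addr0; apply; lra.
Qed.

(* Gibbs' inequality: any conditional code k bounds H(eta | zeta) from above. *)
Lemma partition_entropy_pair_le (Y Z : finType) (eta : T -> Y) (zeta : T -> Z)
    (k : Z -> Y -> R) :
  measurable_partition eta -> measurable_partition zeta ->
  (forall z y, 0 <= k z y) -> (forall z, \sum_y k z y <= 1) ->
  (forall x, 0 < k (zeta x) (eta x)) ->
  partition_entropy mu (fun x => (eta x, zeta x)) <=
  partition_entropy mu zeta + \int[mu]_x (- ln (k (zeta x) (eta x))).
Proof.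
move=> meta mzeta k0 k1 kpos.
have mpair := measurable_partition_pair meta mzeta.
pose pair x := (eta x, zeta x).
pose p yz := fine (mu (pair @^-1` [set yz])).
pose r z := fine (mu (zeta @^-1` [set z])).
have p0 yz : 0 <= p yz by exact: fine_probability_ge0.
have rE z : r z = \sum_y p (y, z).
  rewrite /r -[zeta]/(snd \o pair) label_probability_comp//.
  transitivity (\sum_y \sum_(z' | z' == z) p (y, z')).
    by rewrite pair_big/=; apply: eq_big => -[].
  by apply: eq_bigr => y _; rewrite big_pred1_eq.
rewrite (expectation_label mu mpair (fun yz => - ln (k yz.2 yz.1))).
rewrite /partition_entropy -/pair -subr_ge0.
have -> : \sum_z r z * ln (r z) = \sum_yz p yz * ln (r yz.2).
  transitivity (\sum_y \sum_z p (y, z) * ln (r z)).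
    by rewrite exchange_big; apply: eq_bigr => z _; rewrite {1}rE mulr_suml.
  by rewrite pair_big/=; apply: eq_big => -[].
rewrite -/p opprK [leRHS]addrAC -!sumrN -!big_split/=.
(* The joint masses sum to 1 and the products [r z * k z y] to at most 1, so this middle sum is
   nonnegative; each of its terms is then compared by [ln t <= t - 1] at
   [t = r z * k z y / p (y, z)]. *)
apply: (@le_trans _ _ (\sum_yz (p yz - r yz.2 * k yz.2 yz.1))).
  rewrite big_split/= [X in X + _](sum_label_probability mu mpair) sumrN subr_ge0.
  have -> : \sum_i r i.2 * k i.2 i.1 = \sum_z \sum_y r z * k z y.
    by rewrite exchange_big pair_big/=; apply: eq_big => -[].
  rewrite -(sum_label_probability mu mzeta); apply: ler_sum => z _.
  by rewrite -mulr_sumr ler_piMr//; exact: fine_probability_ge0.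
apply: ler_sum => -[y z] _ /=; rewrite -/(p (y, z)); set a := p _.
have [->|a0] := eqVneq a 0.
  rewrite !(mul0r, mulr0, oppr0, addr0, add0r).  rewrite oppr_le0 mulr_ge0//.
  exact: fine_probability_ge0.
have {}a0 : 0 < a by rewrite lt0r a0 p0.
have ra : a <= r z by rewrite rE (bigD1 y)//= lerDl sumr_ge0.
(* Positivity of the code is assumed only at labels that occur, and an atom of positive mass is
   nonempty. *)
have kyz : 0 < k z y.
  have [[x [<- <-]]|/forallNP pempty] := pselect (exists x, pair x = (y, z)) => //.
  move: a0; rewrite /a /p (_ : _ @^-1` _ = set0) ?measure0 ?ltxx//.
  by rewrite -subset0 => x /pempty.
have rz := lt_le_trans a0 ra.
have ln_le : ln (r z) + ln (k z y) - ln a <= r z * k z y / a - 1.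
  rewrite -lnM ?posrE// -ln_div ?posrE ?mulr_gt0//.
  by apply: ln_le_subr1; rewrite divr_gt0// mulr_gt0.
have := ler_wpM2l (ltW a0) ln_le.
have -> : a * (r z * k z y / a - 1) = r z * k z y - a by field; rewrite gt_eqF.
by lra.
Qed.

End entropy.

(** * Stationary processes and their block entropies *)

Section process.
Context d (T : measurableType d) (R : realType) (mu : probability T R).
Context (S : T -> T) (Y : finType) (b : T -> Y).

Definition itinerary (x : T) (n : nat) : Y := b (iter n S x).

Hypothesis mS : measurable_fun setT S.
Hypothesis invS : invariant_measure S mu.
Hypothesis mb : measurable_partition b.

Lemma measurable_partition_iter (J : finType) (xi : T -> J) n :
  measurable_partition xi -> measurable_partition (xi \o iter n S).
Proof.
move=> mxi; elim: n => [|n IH] //= j; rewrite -[X in measurable X]setTI.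
rewrite (_ : _ @^-1` _ = S @^-1` ((xi \o iter n S) @^-1` [set j])).
  exact: mS.
by apply/seteqP; split => x /=; rewrite -iterS iterSr.
Qed.

Lemma measurable_partition_join (J : finType) (xi : T -> J) n :
  measurable_partition xi -> measurable_partition (join_partition S xi n).
Proof.
move=> mxi; apply: measurable_partition_ffun => i.
exact: measurable_partition_iter.
Qed.

Lemma label_probability_iter (J : finType) (xi : T -> J) n j :
  measurable_partition xi ->
  mu ((xi \o iter n S) @^-1` [set j]) = mu (xi @^-1` [set j]).
Proof.
move=> mxi; elim: n => [//|n IH]; rewrite -IH.
rewrite -(invS (measurable_partition_iter n mxi j)); congr (mu _).
by apply/seteqP; split => x /=; rewrite -iterS iterSr.
Qed.

Lemma partition_entropy_iter (J : finType) (xi : T -> J) n :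
  measurable_partition xi ->
  partition_entropy mu (xi \o iter n S) = partition_entropy mu xi.
Proof.
move=> mxi; rewrite /partition_entropy.
by under eq_bigr do rewrite label_probability_iter//.
Qed.

Lemma expectation_iter (J : finType) (xi : T -> J) (phi : J -> R) n :
  measurable_partition xi ->
  \int[mu]_x phi (xi (iter n S x)) = \int[mu]_x phi (xi x).
Proof.
move=> mxi; rewrite (expectation_label mu (measurable_partition_iter n mxi) phi).
rewrite (expectation_label mu mxi phi).
by apply: eq_bigr => j _; rewrite label_probability_iter.
Qed.

End process.

(** Functions of finitely many letters are kept as functions of infinite sequences, so that
    prepending or dropping letters does not change their type. *)
Definition depends_on (V W : Type) (q : nat) (g : (nat -> V) -> W) :=
  forall w w', (forall i, (i < q)%N -> w i = w' i) -> g w = g w'.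

Lemma depends_onW (V W : Type) (q q' : nat) (g : (nat -> V) -> W) :
  (q <= q')%N -> depends_on q g -> depends_on q' g.
Proof. by move=> qq' gq w w' ww'; apply: gq => i /leq_trans/(_ qq'); exact: ww'. Qed.

(** The padding letter [y0] is invisible to functions that depend on at most [n] letters. *)
Definition extend (Y : Type) (y0 : Y) (n : nat) (w : 'I_n -> Y) (i : nat) : Y :=
  if insub i is Some j then w j else y0.

Lemma extendE (Y : Type) (y0 : Y) n (w : 'I_n -> Y) (i : 'I_n) :
  extend y0 w i = w i.
Proof. by rewrite /extend valK. Qed.

Section itinerary.
Context d (T : measurableType d) (R : realType) (mu : probability T R).
Context (S : T -> T) (Y : finType) (b : T -> Y).
Hypothesis mS : measurable_fun setT S.
Hypothesis invS : invariant_measure S mu.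
Hypothesis mb : measurable_partition b.
Local Notation itin := (itinerary S b).

Lemma itineraryS x : itin (S x) = (fun n => itin x n.+1).
Proof. by apply/funext => n; rewrite /itinerary iterSr. Qed.

Lemma depends_on_itinerary (W : Type) q n (g : (nat -> Y) -> W) x :
  depends_on q g -> (q <= n)%N ->
  g (itin x) = g (extend (b point) (join_partition S b n x)).
Proof.
move=> gq qn; apply: gq => i iq; have ni := leq_trans iq qn.
by rewrite -[i]/(val (Ordinal ni)) extendE ffunE.
Qed.

Lemma bounded_measurable_itinerary q (g : (nat -> Y) -> R) :
  depends_on q g -> bounded_measurable (fun x => g (itin x)).
Proof.
move=> gq; under eq_fun do rewrite (depends_on_itinerary _ gq (leqnn q)).
apply: (bounded_measurable_label _ (fun w : {ffun 'I_q -> Y} => g (extend _ w))).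
exact: measurable_partition_join.
Qed.

Lemma bounded_measurable_itineraryS q (g : (nat -> Y) -> R) :
  depends_on q g -> bounded_measurable (fun x => g (itin (S x))).
Proof.
move=> gq; under eq_fun do rewrite itineraryS.
apply: (@bounded_measurable_itinerary q.+1 (fun w => g (fun n => w n.+1))) => w w' ww'.
by apply: gq => i iq; exact: ww'.
Qed.

Lemma expectation_itineraryS q (g : (nat -> Y) -> R) : depends_on q g ->
  \int[mu]_x g (itin (S x)) = \int[mu]_x g (itin x).
Proof.
move=> gq.
have mq : measurable_partition (join_partition S b q) by exact: measurable_partition_join.
pose phi (w : {ffun 'I_q -> Y}) := g (extend (b point) w).
under eq_Rintegral do rewrite (depends_on_itinerary _ gq (leqnn q)).
under [RHS]eq_Rintegral do rewrite (depends_on_itinerary _ gq (leqnn q)).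
exact: (expectation_iter mS invS phi 1 mq).
Qed.

(** * Codes for the present letter given the future *)

Section coding.
Context (q : nat) (K : (nat -> Y) -> Y -> R).
Hypothesis K_dep : depends_on q K.
Hypothesis K_ge0 : forall w y, 0 <= K w y.
Hypothesis K_sum : forall w, \sum_y K w y <= 1.
Hypothesis K_gt0 : forall x, 0 < K (itin (S x)) (b x).

(** Mean cost, in nats, of the letter [b x] when the later itinerary is known and [K] gives the code
    probabilities. *)
Definition code_length := \int[mu]_x (- ln (K (itin (S x)) (b x))).

Lemma bounded_measurable_code :
  bounded_measurable (fun x => - ln (K (itin (S x)) (b x))).
Proof.
under eq_fun do rewrite itineraryS.
apply: (@bounded_measurable_itinerary q.+1
  (fun w => - ln (K (fun n => w n.+1) (w 0%N)))) => w w' ww'.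
by rewrite ww'// (@K_dep _ (fun n => w' n.+1))// => i iq; exact: ww'.
Qed.

Lemma code_length_ge0 : 0 <= code_length.
Proof.
rewrite -(expectation_cst mu 0); apply: le_expectation => [||x].
- exact: bounded_measurable_cst.
- exact: bounded_measurable_code.
rewrite oppr_ge0 ln_le0// (le_trans _ (K_sum (itin (S x))))//.
by rewrite (bigD1 (b x))//= lerDl sumr_ge0.
Qed.

(** A block of [n.+1] letters at [x] is the letter [b x] followed by the [n]-block at [S x]. The
    latter has the entropy of the [n]-block at [x] by invariance, and since [q <= n] it contains all
    that [K] reads, so Gibbs' inequality applies. *)
Lemma partition_entropy_joinS n : (q <= n)%N ->
  partition_entropy mu (join_partition S b n.+1) <=
  partition_entropy mu (join_partition S b n) + code_length.
Proof.
move=> qn; pose zeta := join_partition S b n \o S.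
have mjoin : measurable_partition (join_partition S b n).
  exact: measurable_partition_join.
have mzeta : measurable_partition zeta.
  exact: (@measurable_partition_iter _ _ S mS _ _ 1).
have mpair := measurable_partition_pair mb mzeta.
pose h (yz : Y * {ffun 'I_n -> Y}) : {ffun 'I_n.+1 -> Y} :=
  [ffun i => if unlift ord0 i is Some j then yz.2 j else yz.1].
have -> : join_partition S b n.+1 = h \o (fun x => (b x, zeta x)).
  apply/funext => x; apply/ffunP => i; rewrite !ffunE/=.
  by case: unliftP => [j|] ->//=; rewrite ffunE -iterS iterSr.
apply: (le_trans (partition_entropy_comp mu _ mpair)).
rewrite -(partition_entropy_iter mS invS 1 mjoin).
pose k (z : {ffun 'I_n -> Y}) := K (extend (b point) z).
have kE x : k (zeta x) (b x) = K (itin (S x)) (b x).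
  by rewrite /k /zeta/= -(depends_on_itinerary _ K_dep qn).
have -> : code_length = \int[mu]_x (- ln (k (zeta x) (b x))).
  by apply: eq_Rintegral => x _; rewrite kE.
by apply: partition_entropy_pair_le => // [z y|z|x]; rewrite ?kE//; exact: K_ge0 || exact: K_sum.
Qed.

Lemma partition_entropy_join_le n :
  partition_entropy mu (join_partition S b (n + q)) <=
  partition_entropy mu (join_partition S b q) + code_length *+ n.
Proof.
elim: n => [|n IH]; first by rewrite mulr0n addr0.
rewrite addSn (le_trans (partition_entropy_joinS (leq_addl _ _)))//.
by rewrite mulrSr addrA lerD2r.
Qed.

(* A divergent sequence of block entropies has junk limit 0, which is
   harmless since code lengths are nonnegative. *)
Lemma entropy_of_partition_le (J : finType) (xi : T -> J) (r : nat) (c : Y -> J) :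
  measurable_partition xi -> (forall x, xi (iter r S x) = c (b x)) ->
  entropy_of_partition S mu xi <= code_length.
Proof.
move=> mxi xic; rewrite /entropy_of_partition; set u := fun n => _.
have [cu|/dvgP ->] := pselect (cvgn u); last exact: code_length_ge0.
pose C := partition_entropy mu (join_partition S b q).
have ule n : u (n + q)%N <= (C + code_length *+ n) / (n + q)%:R.
  rewrite /u ler_wpM2r ?invr_ge0//.
  apply: le_trans (partition_entropy_join_le n).
  (* By invariance the block of [xi] may be delayed by [r] steps, after which it is a letterwise
     function of the block of [b]. *)
  rewrite -(partition_entropy_iter mS invS r); last exact: measurable_partition_join.
  pose h (w : {ffun 'I_(n + q) -> Y}) : {ffun 'I_(n + q) -> J} := [ffun i => c (w i)].
  rewrite (_ : _ \o _ = h \o join_partition S b (n + q)).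
    by apply: partition_entropy_comp; exact: measurable_partition_join.
  apply/funext => x; apply/ffunP => i; rewrite !ffunE/= -xic.
  by rewrite -!iterD addnC.
have cuq : u (n + q)%N @[n --> \oo] --> limn u by rewrite (cvg_shiftn q).
have harm : (n + q)%:R^-1 @[n --> \oo] --> (0 : R).
  rewrite (cvg_shiftn q (fun n => n%:R^-1 : R)).
  by rewrite -cvg_shiftS; exact: cvg_harmonic.
have cbound : code_length + (C - code_length *+ q) * (n + q)%:R^-1 @[n --> \oo]
    --> code_length.
  rewrite -[X in _ --> X]addr0 -(mulr0 (C - code_length *+ q)).
  by apply: cvgD; [exact: cvg_cst | apply: cvgM; [exact: cvg_cst|]].
rewrite -(cvg_lim _ cuq)// -(cvg_lim _ cbound)//.
apply: ler_lim; [by apply/cvg_ex; eexists; exact: cuq|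
                 by apply/cvg_ex; eexists; exact: cbound|].
near=> n; apply: (le_trans (ule n)).
rewrite le_eqVlt; apply/orP; left; apply/eqP.
have n0 : (n + q)%:R != 0 :> R.
  by rewrite pnatr_eq0 -lt0n addn_gt0; apply/orP; left; near: n; exact: nbhs_infty_gt.
rewrite -[code_length *+ n]mulr_natr -[code_length *+ q]mulr_natr.
by rewrite natrD in n0 *; field.
Unshelve. all: by end_near.
Qed.

End coding.
End itinerary.

(** * The transfer operator and the entropy deficit *)

Section transfer_operator.
Context (R : realType) (s : nat) (A : 'M[R]_s) (lam : R).
Context (u : 'rV[R]_s) (v : 'cV[R]_s).

(* Transition probabilities of the Parry chain read backwards in time. *)
Definition backward_matrix (i j : 'I_s) : R := u 0 i * A i j / (lam * u 0 j).

Definition cons_word (V : Type) (i : V) (w : nat -> V) (n : nat) : V :=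
  if n is m.+1 then w m else i.

(** Conditional expectation of [g] under the Parry measure, given all letters but the first. *)
Definition transfer (g : (nat -> 'I_s) -> R) (w : nat -> 'I_s) : R :=
  \sum_i backward_matrix i (w 0%N) * g (cons_word i w).

Hypothesis h01 : zero_one_mx A.
Hypothesis hperron : perron_data A lam u v.

Lemma lam_gt0 : 0 < lam.
Proof. exact: lt_trans (perron_gt1 hperron). Qed.
Local Hint Resolve lam_gt0 : core.

Lemma backward_matrix_ge0 i j : 0 <= backward_matrix i j.
Proof.
have u0 := perron_left_gt0 hperron.
rewrite divr_ge0 ?mulr_ge0 ?(ltW (u0 _)) ?(ltW lam_gt0)//.
by case: (h01 i j) => ->.
Qed.

Lemma sum_backward_matrix j : \sum_i backward_matrix i j = 1.
Proof.
have u0 := perron_left_gt0 hperron j.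
rewrite -mulr_suml; have /matrixP/(_ 0 j) := perron_left hperron.
by rewrite !mxE => ->; rewrite divff// gt_eqF// mulr_gt0.
Qed.

(** One letter is absorbed by prepending, but [backward_matrix] always reads the first remaining
    letter; hence the lower limit of one letter. *)
Lemma depends_on_transfer q g :
  depends_on q.+2 g -> depends_on q.+1 (transfer g).
Proof.
move=> gq w w' ww'; apply: eq_bigr => i _; rewrite ww'//; congr (_ * _).
by apply: gq => -[|n]//= ?; exact: ww'.
Qed.

Lemma norm_transfer_le g M w :
  (forall w', `|g w'| <= M) -> `|transfer g w| <= M.
Proof.
move=> gM; rewrite (le_trans (ler_norm_sum _ _ _))//.
rewrite -[leRHS]mul1r -(sum_backward_matrix (w 0%N)) mulr_suml.
apply: ler_sum => i _; rewrite normrM (ger0_norm (backward_matrix_ge0 _ _)).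
by rewrite ler_wpM2l// backward_matrix_ge0.
Qed.

Lemma transferD f g w :
  transfer (fun w' => f w' + g w') w = transfer f w + transfer g w.
Proof. by rewrite -big_split; apply: eq_bigr => i _; rewrite mulrDr. Qed.

Lemma transfer_sum (I : Type) (r : seq I) (g : I -> (nat -> 'I_s) -> R) w :
  transfer (fun w' => \sum_(i <- r) g i w') w = \sum_(i <- r) transfer (g i) w.
Proof.
rewrite /transfer exchange_big; apply: eq_bigr => i _.
by rewrite mulr_sumr.
Qed.

(** From [- ln (1 + y) <= 1 / (1 + y) - 1]; what remains is [y ^+ 2 * (1 + 2 * y) / (1 + y)],
    nonnegative exactly because [y >= - 1/2]. *)
Lemma ln1D_ge (y : R) : `|y| <= 2^-1 -> - ln (1 + y) <= - y + 2 * y ^+ 2.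
Proof.
rewrite ler_norml => /andP[y_ge y_le]; have y1 : 0 < 1 + y by lra.
rewrite -lnV ?posrE// (le_trans (ln_le_subr1 _)) ?invr_gt0//.
rewrite -subr_ge0 (_ : _ - _ = y ^+ 2 * (1 + 2 * y) / (1 + y)).
  apply: divr_ge0 (ltW y1); apply: mulr_ge0 (sqr_ge0 y) _; lra.
by field; rewrite gt_eqF.
Qed.

Section deficit.
Context d (T : measurableType d) (mu : probability T R) (S : T -> T).
Context (a : T -> 'I_s).
Hypothesis mS : measurable_fun setT S.
Hypothesis invS : invariant_measure S mu.
Hypothesis ma : measurable_partition a.
Hypothesis adm : forall x, A (a x) (a (S x)) = 1.
Local Notation itin := (itinerary S a).

Lemma cons_itinerary x : cons_word (a x) (itin (S x)) = itin x.
Proof. by apply/funext => -[|n]//=; rewrite /itinerary iterSr. Qed.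

(** Along admissible points the integrand is [ln lam] plus the coboundary of [ln u], which every
    invariant measure integrates to 0. *)
Lemma expectation_ln_backward :
  \int[mu]_x (- ln (backward_matrix (a x) (a (S x)))) = ln lam.
Proof.
have u0 := perron_left_gt0 hperron.
pose l w : R := ln (u 0 (w 0%N)).
have ldep : depends_on 1 l by move=> w w' ww'; rewrite /l ww'.
have bl := bounded_measurable_itinerary mS ma ldep.
have blS := bounded_measurable_itineraryS mS ma ldep.
transitivity (\int[mu]_x (ln lam + (l (itin (S x)) - l (itin x)))).
  apply: eq_Rintegral => x _; rewrite /backward_matrix adm mulr1.
  by rewrite ln_div ?lnM ?posrE ?mulr_gt0// /l /itinerary/=; ring.
rewrite expectationD ?expectationB ?expectation_cst//.
- by rewrite (expectation_itineraryS mS invS ma ldep) subrr addr0.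
- exact: bounded_measurable_cst.
- exact: bounded_measurableB.
Qed.

(* The conditional code K charges the Parry chain tilted by the bounded
   martingale difference G - transfer G, times a cheap description of xi
   given the itinerary. *)
Lemma entropy_deficit q (G : (nat -> 'I_s) -> R) (B : R)
    (J : finType) (xi : T -> J) (X := \int[mu]_x G (itin x) -
      \int[mu]_x transfer G (itin x)) :
  depends_on q.+1 G -> 0 < B -> (forall w, `|G w| <= B) ->
  measurable_partition xi ->
  (forall delta, 0 < delta -> exists r q' (eta : (nat -> 'I_s) -> J),
    depends_on q' eta /\
    \int[mu]_x ((xi (iter r S x) != eta (itin x))%:R : R) <= delta) ->
  entropy_of_partition S mu xi <= ln lam - X ^+ 2 / (32 * B ^+ 2).
Proof.
move=> Gdep B0 GB mxi approx.
have Gdep2 : depends_on q.+2 G by exact: depends_onW Gdep.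
have LGdep := depends_on_transfer Gdep2.
have LGB w := norm_transfer_le w GB.
have bG := bounded_measurable_itinerary mS ma Gdep.
have bLG := bounded_measurable_itinerary mS ma LGdep.
have bLGS := bounded_measurable_itineraryS mS ma LGdep.
have X_le : `|X| <= 2 * B.
  rewrite (le_trans (ler_normB _ _))// mulr_natl mulr2n.
  by rewrite lerD// norm_expectation_le.
(* Maximizes [t * X - 8 * t ^+ 2 * B ^+ 2], the gain of the tilt; the 8 comes from
   [2 * (t * D) ^+ 2] with [D] at most [2 * B] in absolute value. *)
pose t := X / (16 * B ^+ 2).
pose D i w := G (cons_word i w) - transfer G w.
have tD i w : `|t * D i w| <= 2^-1.
  have DB : `|D i w| <= 2 * B.
    by rewrite (le_trans (ler_normB _ _))// mulr_natl mulr2n lerD.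
  rewrite normrM /t normrM normfV (ger0_norm (_ : 0 <= 16 * B ^+ 2)); last first.
    by apply: mulr_ge0 => //; exact: sqr_ge0.
  rewrite mulrAC ler_pdivrMr ?mulr_gt0 ?exprn_gt0//.
  by rewrite (le_trans (ler_pM _ _ X_le DB))//; nra.
apply/ler_addgt0Pr => e e0.
pose n := #|J|.
have n0 : 0 < n%:R :> R by rewrite ltr0n; apply/card_gt0P; exists (xi point).
(* Chosen so that confirming a correct guess of the label costs at most [e / 2]. *)
pose eps : R := 1 - expR (- (e / 2)).
have eps0 : 0 < eps by rewrite subr_gt0 expR_lt1 oppr_lt0 divr_gt0.
have ln_eps : - ln (1 - eps) = e / 2 by rewrite /eps subKr expRK opprK.
pose c := `|ln (eps / n%:R)|.
(* A wrong guess costs at most [c]; at this error rate wrong guesses contribute at most [e / 2] on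
   average. The [+ 1] keeps the denominator positive. *)
have [|r [q' [eta [etadep etale]]]] := approx (e / 2 / (c + 1)).
  by rewrite divr_gt0 ?divr_gt0// ltr_wpDl// normr_ge0.
pose b x := (xi (iter r S x), a x).
have mb : measurable_partition b.
  by apply: measurable_partition_pair => //; exact: measurable_partition_iter.
(* Code for the label of [xi]: weight [1 - eps] on the guess [eta w], and [eps] spread uniformly so
   that no label is impossible. *)
pose kappa w j : R := (1 - eps) * (j == eta w)%:R + eps / n%:R.
have kappa_ge w j : eps / n%:R <= kappa w j.
  by rewrite lerDr mulr_ge0// subKr expR_ge0.
have epsn0 : 0 < eps / n%:R by rewrite divr_gt0.
have kappa_gt0 w j : 0 < kappa w j by exact: lt_le_trans (kappa_ge w j).
(* The letter is coded first, by the tilted backward chain; the label is then coded given the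
   itinerary that includes this letter. *)
pose K (w : nat -> J * 'I_s) (ji : J * 'I_s) :=
  kappa (cons_word ji.2 (snd \o w)) ji.1 *
  (backward_matrix ji.2 (w 0%N).2 * (1 + t * D ji.2 (snd \o w))).
have tilt_gt0 i w : 0 < 1 + t * D i w.
  by have := tD i w; rewrite ler_norml => /andP[]; lra.
have backx x : 0 < backward_matrix (a x) (a (S x)).
  have u0 := perron_left_gt0 hperron.
  by rewrite /backward_matrix adm mulr1 divr_gt0// mulr_gt0.
have sndE x : snd \o itinerary S b x = itin x by [].
pose Q := (q.+1 + q')%N.
have Kdep : depends_on Q K.
  move=> w w' ww'; apply/funext => -[j i]; rewrite /K /=.
  have eq_snd m : (m < Q)%N -> (snd \o w) m = (snd \o w') m by move=> mQ /=; rewrite ww'.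
  rewrite ww'// /kappa /D (etadep _ (cons_word i (snd \o w'))); last first.
    by move=> [|m]//= mq; apply: eq_snd; rewrite (leq_trans (ltnW mq))// leq_addl.
  rewrite (LGdep _ (snd \o w')); last first.
    by move=> m mq; apply: eq_snd; rewrite (leq_trans mq)// leq_addr.
  rewrite (Gdep _ (cons_word i (snd \o w')))//.
  by move=> [|m]//= mq; apply: eq_snd; rewrite (leq_trans (ltnW mq))// leq_addr.
have K0 w ji : 0 <= K w ji.
  by rewrite mulr_ge0 ?(ltW (kappa_gt0 _ _))// mulr_ge0 ?backward_matrix_ge0// ltW.
have Kpos x : 0 < K (itinerary S b (S x)) (b x).
  by rewrite mulr_gt0// mulr_gt0//; exact: backx.
(* The label code sums to 1, and the tilt preserves total mass because [D] has mean 0 under the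
   backward probabilities. *)
have K1 w : \sum_ji K w ji <= 1.
  pose w2 := snd \o w.
  have -> : \sum_ji K w ji = \sum_i \sum_j kappa (cons_word i w2) j *
     (backward_matrix i (w2 0%N) * (1 + t * D i w2)).
    by rewrite exchange_big pair_big/=; apply: eq_big => -[].
  under eq_bigr => i _.
    rewrite -mulr_suml big_split/= -mulr_sumr (bigD1 (eta (cons_word i w2)))//= eqxx.
    rewrite big1 => [|j /negPf ->//]; rewrite addr0 mulr1 sumr_const.
    rewrite -[X in _ + X]mulr_natr divfK ?gt_eqF// subrK mul1r mulrDr mulr1.
    rewrite mulrCA /D mulrBr.
    over.
  rewrite big_split/= sum_backward_matrix -mulr_sumr sumrB -mulr_suml.
  by rewrite sum_backward_matrix mul1r subrr mulr0 addr0.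
have hxi : forall x, xi (iter r S x) = fst (b x) by [].
apply: (le_trans (entropy_of_partition_le mS invS mb Kdep K0 K1 Kpos mxi hxi)).
pose bad x : R := (xi (iter r S x) != eta (itin x))%:R.
have bbad : bounded_measurable bad.
  apply: (@bounded_measurable_itinerary _ _ _ S _ b mS mb q'.+1
    (fun w => ((w 0%N).1 != eta (snd \o w))%:R)) => w w' ww'.
  by rewrite ww'// (etadep _ (snd \o w'))// => m mq /=; rewrite ww'// ltnW.
pose back x : R := - ln (backward_matrix (a x) (a (S x))).
have bback : bounded_measurable back.
  apply: (@bounded_measurable_itinerary _ _ _ S _ a mS ma 2
    (fun w => - ln (backward_matrix (w 0%N) (w 1%N)))) => w w' ww'.
  by rewrite !ww'.
pose bound x := e / 2 + c * bad x + (back x + (t * (transfer G (itin (S x)) - G (itin x))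
   + 8 * t ^+ 2 * B ^+ 2)).
have pointwise x : - ln (K (itinerary S b (S x)) (b x)) <= bound x.
  rewrite /K/= sndE cons_itinerary.
  rewrite lnM ?posrE; [|exact: kappa_gt0|exact: mulr_gt0 (backx x) (tilt_gt0 _ _)].
  rewrite lnM ?posrE; [|exact: backx|exact: tilt_gt0].
  rewrite !opprD; apply: lerD.
    rewrite /kappa /bad; case: eqP => _ /=; rewrite ?mulr1 ?mulr0 ?addr0 ?add0r.
      rewrite -ln_eps lerN2 ler_ln ?posrE ?lerDl ?ltW//.
      + by rewrite subKr expR_gt0.
      + by rewrite addr_gt0// subKr expR_gt0.
    by have := ler_norm (- ln (eps / n%:R)); rewrite normrN -/c; lra.
  have D2 : D (a x) (itin (S x)) ^+ 2 <= 4 * B ^+ 2.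
    rewrite (_ : 4 * B ^+ 2 = (2 * B) ^+ 2); last by ring.
    rewrite -real_normK ?num_real// ler_sqr ?nnegrE ?mulr_ge0 ?(ltW B0)//.
    by rewrite (le_trans (ler_normB _ _))// mulr_natl mulr2n lerD.
  apply: lerD => //; have := ln1D_ge (tD (a x) (itin (S x))).
  have := ler_wpM2l (sqr_ge0 t) D2.
  by rewrite /D cons_itinerary; lra.
have bdiff : bounded_measurable (fun x => transfer G (itin (S x)) - G (itin x)).
  exact: bounded_measurableB.
have btilt : bounded_measurable (fun x =>
    t * (transfer G (itin (S x)) - G (itin x)) + 8 * t ^+ 2 * B ^+ 2).
  apply: bounded_measurableD; first exact: bounded_measurableZ.
  exact: bounded_measurable_cst.
have bcbad : bounded_measurable (fun x => e / 2 + c * bad x).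
  apply: bounded_measurableD; first exact: bounded_measurable_cst.
  exact: bounded_measurableZ.
have bbt := bounded_measurableD bback btilt.
apply: (@le_trans _ _ (\int[mu]_x bound x)).
  apply: le_expectation pointwise; last exact: bounded_measurableD.
  exact: bounded_measurable_code Kdep.
have bcst r : bounded_measurable (fun=> r : R) := bounded_measurable_cst T r.
rewrite /bound (expectationD mu bcbad bbt) (expectationD mu bback btilt).
rewrite (expectationD mu (bcst (e / 2)) (bounded_measurableZ c bbad)).
rewrite (expectationD mu (bounded_measurableZ t bdiff) (bcst _)).
rewrite (expectationZ mu c bbad) (expectationZ mu t bdiff).
rewrite expectationB// !expectation_cst expectation_ln_backward.
(* Invariance replaces [S x] by [x] in the transfer term, so the linear part of the bound becomes
   [- t * X]. *)
rewrite (expectation_itineraryS mS invS ma LGdep).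
rewrite -[_ - _ in X in t * X]opprB -/X.
have cbad : c * \int[mu]_x bad x <= e / 2.
  apply: (le_trans (ler_wpM2l (normr_ge0 _) etale)); rewrite -/c.
  rewrite mulrA ler_pdivrMr ?ltr_wpDl ?normr_ge0//.
  by rewrite mulrDr mulr1 mulrC lerDl ltW// divr_gt0.
have -> : X ^+ 2 / (32 * B ^+ 2) = t * X - 8 * t ^+ 2 * B ^+ 2.
  by rewrite /t; field; rewrite gt_eqF.
lra.
Qed.

End deficit.
End transfer_operator.

(** * The Poisson equation *)

Section poisson.
Context (R : realType) (s : nat) (A : 'M[R]_s) (lam : R).
Context (u : 'rV[R]_s) (v : 'cV[R]_s).
Hypothesis h01 : zero_one_mx A.
Hypothesis hirr : irreducible_mx A.
Hypothesis hperron : perron_data A lam u v.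
Local Notation back := (backward_matrix A lam u).
Local Notation trans := (transfer A lam u).
Local Notation p := (parry_vector u v).

(** A positive entry of a power of [A] gives an admissible path from [i] to [j], along which [P] is
    carried backwards. *)
Lemma irreducible_closed (P : 'I_s -> Prop) :
  (forall i j, A i j = 1 -> P j -> P i) -> forall i j, P j -> P i.
Proof.
move=> Pclosed i j Pj; have [n [_]] := hirr i j.
elim: n i => [|n IH] i.
  by rewrite expr0 mxE; case: eqP => [-> //|]; rewrite ltxx.
rewrite exprS mxE => sum_gt0.
have [l] : exists l, 0 < A i l * (A ^+ n) l j.
  apply: contrapT => /forallNP le0; move: sum_gt0; rewrite ltNge => /negP; apply.
  by apply: sumr_le0 => l _; rewrite leNgt; exact/negP.
case: (h01 i l) => Ail; rewrite Ail ?mul0r ?ltxx// mul1r => /IH.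
exact: Pclosed.
Qed.

(** Stationarity of the Parry vector for the reversed chain; this is the right eigenvector
    equation. *)
Lemma sum_backward_parry i : \sum_j back i j * p j = p i.
Proof.
have lam0 := lam_gt0 hperron.
have /matrixP/(_ i 0) := perron_right hperron; rewrite !mxE => Av.
transitivity (u 0 i / lam * \sum_j A i j * v j 0).
  rewrite mulr_sumr; apply: eq_bigr => j _.
  have u0 := perron_left_gt0 hperron j.
  by rewrite /backward_matrix /parry_vector; field; rewrite !gt_eqF.
by rewrite Av /parry_vector; field; rewrite gt_eqF.
Qed.

(** Maximum principle: where an average equals the maximum, all predecessors attain the maximum as
    well, and irreducibility spreads this to every state. *)
Lemma harmonic_const (x : 'I_s -> R) :
  (forall j, x j = \sum_i back i j * x i) -> forall i j, x i = x j.
Proof.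
move=> xharm i j.
pose m := [arg max_(k > i) x k]%O.
have xm k : x k <= x m by rewrite /m; case: arg_maxP => // ? _; apply.
suff xE k : x k = x m by rewrite (xE i) (xE j).
apply: (@irreducible_closed (fun k => x k = x m) _ k m erefl) => k' l Akl xl.
have sum0 : \sum_(k' < s) back k' l * (x m - x k') = 0.
  under eq_bigr do rewrite mulrBr.
  by rewrite sumrB -mulr_suml (sum_backward_matrix hperron) -xharm xl mul1r subrr.
have /psumr_eq0P/(_ sum0)/(_ k' isT)/eqP : forall i', true -> 0 <= back i' l * (x m - x i').
  by move=> i' _; rewrite mulr_ge0 ?subr_ge0// (backward_matrix_ge0 h01 hperron).
have u0 := perron_left_gt0 hperron; have lam0 := lam_gt0 hperron.
rewrite /backward_matrix Akl mulr1.
by rewrite mulf_eq0 gt_eqF ?divr_gt0 ?mulr_gt0//= subr_eq0 => /eqP ->.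
Qed.

(** Inverse of the fundamental matrix of the reversed chain. The rank-one term [p i] makes it
    invertible, as the other terms annihilate constants. *)
Definition poisson_matrix : 'M[R]_s :=
  \matrix_(i, j) ((i == j)%:R - back i j + p i).

Lemma mul_poisson_matrix (y : 'rV[R]_s) j :
  (y *m poisson_matrix) 0 j =
  y 0 j - \sum_i back i j * y 0 i + \sum_i p i * y 0 i.
Proof.
rewrite mxE; under eq_bigr do rewrite mxE mulrDr mulrBr.
rewrite big_split sumrB/=; congr (_ - _ + _).
- rewrite (bigD1 j)//= eqxx mulr1 big1 ?addr0// => i /negPf ->.
  by rewrite mulr0.
- by apply: eq_bigr => i _; rewrite mulrC.
- by apply: eq_bigr => i _; rewrite mulrC.
Qed.

Lemma poisson_mean (y : 'rV[R]_s) :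
  \sum_j p j * (y *m poisson_matrix) 0 j = \sum_j p j * y 0 j.
Proof.
under eq_bigr do rewrite mul_poisson_matrix mulrDr mulrBr.
rewrite big_split sumrB/= -mulr_suml.
have -> : \sum_j p j = 1 by exact: perron_normalized hperron.
rewrite mul1r; set c := \sum_j p j * y 0 j.
have -> : \sum_j p j * (\sum_i back i j * y 0 i) = c.
  under eq_bigr do rewrite mulr_sumr.
  rewrite exchange_big; apply: eq_bigr => i _ /=.
  rewrite -(sum_backward_parry i) mulr_suml; apply: eq_bigr => j _.
  by rewrite mulrA [p j * _]mulrC.
by rewrite subrr add0r.
Qed.

(** A vector in the kernel has mean 0, hence is harmonic, hence constant, hence 0. *)
Lemma poisson_matrix_unit : poisson_matrix \in unitmx.
Proof.
rewrite -row_free_unit; apply/inj_row_free => y yM0.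
have c0 : \sum_j p j * y 0 j = 0.
  by rewrite -poisson_mean yM0 big1// => j _; rewrite mxE mulr0.
have /harmonic_const yconst j : y 0 j = \sum_i back i j * y 0 i.
  have := mul_poisson_matrix y j; rewrite yM0 mxE c0 addr0 => /esym/eqP.
  by rewrite subr_eq0 => /eqP.
apply/rowP => j; rewrite mxE -c0.
under eq_bigr do rewrite (yconst _ j).
by rewrite -mulr_suml [X in X * _](perron_normalized hperron) mul1r.
Qed.

Lemma poisson_letter : exists2 C : R, 0 <= C &
  forall (e : 'I_s -> R) M, (forall i, `|e i| <= M) ->
  exists y : 'I_s -> R, (forall j, `|y j| <= C * M) /\
    forall j, y j - \sum_i back i j * y i = e j - \sum_i p i * e i.
Proof.
(* The solution is [e] times the inverse matrix. It has the same mean as [e], so the rank-one term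
   provides the centering. *)
exists (\sum_i \sum_j `|invmx poisson_matrix i j|).
  by apply: sumr_ge0 => i _; apply: sumr_ge0.
move=> e M eM; pose y := (\row_i e i) *m invmx poisson_matrix.
have yM : y *m poisson_matrix = \row_i e i by rewrite mulmxKV// poisson_matrix_unit.
exists (y 0); split => j.
  rewrite mxE (le_trans (ler_norm_sum _ _ _))// mulr_suml; apply: ler_sum => i _.
  rewrite mxE normrM mulrC ler_pM// (bigD1 j)//= lerDl.
  exact: sumr_ge0.
have := mul_poisson_matrix y j; rewrite yM mxE => ->.
have <- : \sum_i p i * y 0 i = \sum_i p i * e i.
  by rewrite -poisson_mean yM; apply: eq_bigr => i _; rewrite mxE.
by rewrite addrK.
Qed.

(** The Parry integral of a function of [k.+1] letters: after [k] transfers only one letter is read,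
    so evaluation at a constant word loses nothing. *)
Definition parry_mean k (g : (nat -> 'I_s) -> R) : R :=
  \sum_i p i * iter k trans g (fun=> i).

(** If [G] solves the equation for [trans g], then [g + G] solves it for [g]; each letter thus adds
    [M] to the bound. *)
Lemma poisson_word : exists2 C : R, 0 <= C &
  forall k (g : (nat -> 'I_s) -> R) M, depends_on k.+1 g ->
  (forall w, `|g w| <= M) ->
  exists G : (nat -> 'I_s) -> R, [/\ depends_on k.+1 G,
    forall w, `|G w| <= (k%:R + C) * M &
    forall w, G w - trans G w = g w - parry_mean k g].
Proof.
have [C C0 letterC] := poisson_letter; exists C => // k.
elim: k => [|k IH] g M gdep gM.
  have [y [yC yE]] := letterC (fun i => g (fun=> i)) M (fun i => gM _).
  exists (fun w => y (w 0%N)); split => [w w' -> //|w|w].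
    by rewrite add0r.
  rewrite (gdep w (fun=> w 0%N)) => [|[]//]; exact: yE.
have tM w : `|trans g w| <= M by exact: (norm_transfer_le h01 hperron).
have [G [Gdep GM GE]] := IH _ M (depends_on_transfer A lam u gdep) tM.
exists (fun w => g w + G w); split.
- by move=> w w' ww'; congr (_ + _); [exact: gdep | apply: (depends_onW (leqnSn _) Gdep)].
- move=> w; apply: (le_trans (ler_normD _ _)).
  by have := gM w; have := GM w; rewrite -natr1; lra.
- move=> w; rewrite transferD /parry_mean iterSr -/(parry_mean k _).
  by have := GE w; lra.
Qed.

End poisson.

(** * Cylinder structure of subshifts *)

(* Each window consists of finitely many consecutive indices; [off n] steps
   after its first index one reaches the base index. *)
Record finite_windows (tm : time) (base : time_index tm)
    (start : nat -> time_index tm) (len off : nat -> nat) : Prop :=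
  FiniteWindows {
    windowP : forall n i, window n i <->
      exists2 k, (k < len n)%N & i = iter k (@succ_index tm) (start n) ;
    start_base : forall n, iter (off n) (@succ_index tm) (start n) = base ;
    window_mono : forall n i, @window tm n i -> window n.+1 i ;
    window_succ : forall n i, @window tm n i -> window n.+1 (succ_index i) ;
    window_cover : forall i, exists n, @window tm n i ;
    len_le : forall n, (len n <= n.*2)%N }.

Section subshift.
Context (R : realType) (s : nat) (tm : time) (A : 'M[R]_s).
Context (hs : (2 <= s)%N) (hA : aperiodic_mx A).
Local Notation X := (subshift tm hs hA).

Lemma open_letter i j : open [set x : X | letter x i = j].
Proof.
pose V : set (full_shift s tm) := [set x | x i = j].
suff oV : open V by exists V.
pose K (_ : time_index tm) : topologicalType := discrete_topology 'I_s.
have oj : open ([set j] : set (K i)) by exact: discrete_open.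
by have /(continuousP (_ : prod_topology K -> K i)).1/(_ _ oj) := @proj_continuous _ K i.
Qed.

(** Convergence in the product topology is tested coordinatewise, and every coordinate lies in some
    window. *)
Lemma cvg_agree (x : X) :
  (forall i, exists n, @window tm n i) ->
  (forall n i, @window tm n i -> window n.+1 i) ->
  filter_from setT (fun n => [set y : full_shift s tm |
    forall i, window n i -> y i = sval x i]) --> (sval x : full_shift s tm).
Proof.
move=> cover mono.
have mono_le n m i : (n <= m)%N -> @window tm n i -> window m i.
  by move=> /subnK <-; elim: (m - n)%N => //= k IH /IH; exact: mono.
apply/cvg_sup => [|i].
  apply: filter_from_filter; first by exists 0%N.
  move=> n m _ _; exists (maxn n m) => // y yx; split => i wi; apply: yx.
    by apply: mono_le wi; rewrite leq_maxl.
  by apply: mono_le wi; rewrite leq_maxr.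
move=> B [C [[D oD DC] Cx] CB].
have [n win] := cover i; exists n => // y yx; apply: CB.
move: Cx; rewrite -DC /= /proj.
by rewrite (yx i win).
Qed.

Lemma measurable_letter i : measurable_partition (fun x : X => letter x i).
Proof. by move=> j; apply: sub_sigma_algebra; exact: open_letter. Qed.

Lemma letter_iter (x : X) n i :
  letter (iter n shift_map x) i = letter x (iter n (@succ_index tm) i).
Proof. by elim: n x i => [//|n IH] x i; rewrite iterSr IH iterS. Qed.

Definition word_from (a : time_index tm) (x : X) (k : nat) : 'I_s :=
  letter x (iter k (@succ_index tm) a).

Lemma word_from_iter a n x : word_from a (iter n shift_map x) =
  word_from (iter n (@succ_index tm) a) x.
Proof. by apply/funext => k; rewrite /word_from letter_iter -!iterD addnC. Qed.

Lemma word_from_itinerary a x :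
  word_from a x = itinerary shift_map (letter^~ a) x.
Proof. by apply/funext => k; rewrite /itinerary letter_iter. Qed.

Lemma agree_refl n (x : X) : agree n x x.
Proof. by []. Qed.

Lemma agree_sym n (x y : X) : agree n x y -> agree n y x.
Proof. by move=> xy i /xy. Qed.

Lemma agree_trans n (x y z : X) : agree n x y -> agree n y z -> agree n x z.
Proof. by move=> xy yz i wi; rewrite xy// yz. Qed.

Definition determined (W : Type) n (psi : X -> W) :=
  forall x y, agree n x y -> psi x = psi y.

(** A fixed representative of each class of points agreeing on the window; composing with it gives
    the finite-letter approximations of a function. *)
Definition canonical n (x : X) : X := xget point [set y | agree n x y].

Lemma agree_canonical n x : agree n x (canonical n x).
Proof. by rewrite /canonical; case: xgetP => // /(_ x)/(_ (agree_refl x)). Qed.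

Lemma determined_canonical n : determined n (canonical n).
Proof.
move=> x y xy; rewrite /canonical; congr xget.
apply/seteqP; split => z /=; first exact/agree_trans/agree_sym.
exact: agree_trans.
Qed.

Section windows.
Context (base : time_index tm) (start : nat -> time_index tm) (len off : nat -> nat).
Hypothesis fw : finite_windows base start len off.

Lemma agree_le n m (x y : X) : (n <= m)%N -> agree m x y -> agree n x y.
Proof.
move=> /subnK <-; elim: (m - n)%N => [//|k IH] xy.
by apply: IH => i wi; apply: xy; exact: window_mono fw _ _ wi.
Qed.

Lemma agree_wordP n (x y : X) : agree n x y <->
  forall k, (k < len n)%N -> word_from (start n) x k = word_from (start n) y k.
Proof.
split=> [xy k kn|xy i /(windowP fw)[k kn ->]]; last exact: xy.
by apply: xy; apply/(windowP fw); exists k.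
Qed.

(** Lets functions on [X] be evaluated at arbitrary words, as the transfer operator requires; an
    inadmissible word is sent to the default [point]. *)
Definition realize n (w : nat -> 'I_s) : X :=
  xget point [set x | forall k, (k < len n)%N -> word_from (start n) x k = w k].

Lemma depends_on_realize (W : Type) n (psi : X -> W) :
  depends_on (len n) (psi \o realize n).
Proof.
move=> w w' ww' /=; congr psi; congr xget; apply/seteqP; split=> x /= xw k kn.
  by rewrite xw// ww'.
by rewrite xw// ww'.
Qed.

Lemma determined_realize (W : Type) n (psi : X -> W) x : determined n psi ->
  psi (realize n (word_from (start n) x)) = psi x.
Proof.
apply; apply/agree_wordP; rewrite /realize; case: xgetP => [y _ //|/(_ x) /=].
by case.
Qed.

(** The window may begin before the base index. After [off n] shifts it begins at the base and is
    read by the forward itinerary. *)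
Lemma determined_itinerary (W : Type) n (psi : X -> W) x : determined n psi ->
  psi (iter (off n) shift_map x) =
  (psi \o realize n) (itinerary shift_map (letter^~ base) x).
Proof.
move=> dpsi; rewrite /= -word_from_itinerary -(start_base fw n) -word_from_iter.
by rewrite determined_realize.
Qed.

Lemma measurable_word n : measurable_partition
  (fun x : X => [ffun k : 'I_(len n) => word_from (start n) x k]).
Proof. by apply: measurable_partition_ffun => k; exact: measurable_letter. Qed.

Lemma determined_label (W : Type) n (psi : X -> W) : determined n psi ->
  psi = (fun w : {ffun 'I_(len n) -> 'I_s} =>
     psi (realize n (extend (letter (point : X) base) w))) \o
  (fun x : X => [ffun k : 'I_(len n) => word_from (start n) x k]).
Proof.
move=> dpsi; apply/funext => x /=; rewrite -[LHS](determined_realize x dpsi).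
apply: depends_on_realize => k kn.
by rewrite -[k]/(val (Ordinal kn)) extendE ffunE.
Qed.

Lemma measurable_determined (J : finType) n (psi : X -> J) :
  determined n psi -> measurable_partition psi.
Proof.
move=> /determined_label ->.
by apply: measurable_partition_comp; exact: measurable_word.
Qed.

Lemma bounded_measurable_determined n (psi : X -> R) :
  determined n psi -> bounded_measurable psi.
Proof.
move=> /determined_label ->.
by apply: bounded_measurable_label; exact: measurable_word.
Qed.

Lemma measurable_determined_set n (P : set X) :
  determined n P -> measurable P.
Proof.
move=> dP; have mP : measurable_partition (fun x => `[<P x>]).
  by apply: (@measurable_determined _ n) => x y /dP ->.
rewrite (_ : P = (fun x => `[<P x>]) @^-1` [set true])//.
by apply/seteqP; split => x /= /asboolP.
Qed.

Lemma open_agree (U : set X) x : open U -> U x ->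
  exists n, forall y, agree n x y -> U y.
Proof.
move=> [V oV <-] Vx.
have [n _ nV] := cvg_agree (window_cover fw) (window_mono fw) (open_nbhs_nbhs (conj oV Vx)).
by exists n => y xy; apply: nV => i wi; rewrite -/(letter _ _) xy.
Qed.

(** The largest subset of [U] that is decided by the window of level [n]. *)
Definition determined_core n (U : set X) : set X :=
  [set x | forall y, agree n x y -> U y].

Lemma determined_core_determined n U : determined n (determined_core n U).
Proof.
move=> x y xy; apply/propext; split => Ux z.
  by move=> yz; exact/Ux/(agree_trans xy).
by move=> xz; exact/Ux/agree_trans/xz/agree_sym.
Qed.

Lemma open_determined (U : set X) : open U ->
  U = \bigcup_n determined_core n U.
Proof.
move=> oU; apply/seteqP; split => [x /(open_agree oU)[n nU]|x [n _]].
  by exists n.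
by apply.
Qed.

(** An open set is a countable union of determined sets, and shifting a window by one step stays in
    the next window. *)
Lemma measurable_shift : measurable_fun setT (@shift_map R s tm A hs hA).
Proof.
apply: (@measurability _ _ _ _ _ _ (@open X)) => // _ [U oU <-].
rewrite setTI (open_determined oU) preimage_bigcup.
apply: bigcup_measurable => n _; apply: (@measurable_determined_set n.+1) => x y xy.
apply: determined_core_determined => i wi.
exact/(xy _)/(window_succ fw).
Qed.

End windows.
End subshift.

(** * Approximation of measurable partitions by finite-window partitions *)

Section approximation.
Context (R : realType) (s : nat) (tm : time) (A : 'M[R]_s).
Context (hs : (2 <= s)%N) (hA : aperiodic_mx A).
Local Notation X := (subshift tm hs hA).
Context (base : time_index tm) (start : nat -> time_index tm) (len off : nat -> nat).
Hypothesis fw : finite_windows base start len off.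
Context (mu : probability X R).

Definition approximable (B : set X) := forall e : R, 0 < e ->
  exists n (C : set X), determined n C /\ (mu (B `+` C) < e%:E)%E.

Lemma measurable_setY (B C : set X) :
  measurable B -> measurable C -> measurable (B `+` C).
Proof. by move=> mB mC; apply: measurableU; exact: measurableD. Qed.

Lemma approximable_determined n B : determined n B -> approximable B.
Proof.
move=> dB e e0; exists n, B; split => //.
by rewrite setYK measure0 lte_fin.
Qed.

Lemma approximableC B : approximable B -> approximable (~` B).
Proof.
move=> aB e /aB[n [C [dC muC]]]; exists n, (~` C); split.
  by move=> x y /dC Cxy; rewrite /setC/= Cxy.
suff -> : ~` B `+` ~` C = B `+` C by [].
apply/seteqP; split => x [[]|[]] /= Bx Cx.
- by right; split => //; exact: contrapT.
- by left; split => //; exact: contrapT.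
- by right; split => //; exact: contrapT.
- by left; split => //; exact: contrapT.
Qed.

Lemma lt_measureU e1 e2 (B C D : set X) :
  measurable B -> measurable C -> measurable D -> D `<=` B `|` C ->
  (mu B < e1%:E)%E -> (mu C < e2%:E)%E -> (mu D < (e1 + e2)%:E)%E.
Proof.
move=> mB mC mD DBC muB muC.
apply: (@le_lt_trans _ _ (mu (B `|` C))).
  by apply: le_measure => //; rewrite inE//; exact: measurableU.
by rewrite (le_lt_trans (measureU2 _ mB mC))// EFinD lteD.
Qed.

Lemma approximableU B C : measurable B -> measurable C ->
  approximable B -> approximable C -> approximable (B `|` C).
Proof.
move=> mB mC aB aC e e0; have e20 : 0 < e / 2 by rewrite divr_gt0.
have [n [B' [dB' muB']]] := aB _ e20; have [m [C' [dC' muC']]] := aC _ e20.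
have mB' := measurable_determined_set fw dB'.
have mC' := measurable_determined_set fw dC'.
exists (maxn n m), (B' `|` C'); split.
  move=> x y xy; rewrite /setU/= (dB' x y) ?(dC' x y)//;
    by apply: (agree_le fw _ xy); rewrite leq_max leqnn ?orbT.
rewrite [e]splitr; apply: lt_measureU muB' muC'.
- exact: measurable_setY.
- exact: measurable_setY.
- by apply: measurable_setY; exact: measurableU.
move=> x [[[?|?] /not_orP[? ?]]|[[?|?] /not_orP[? ?]]].
- by left; left.
- by right; left.
- by left; right.
- by right; right.
Qed.

(** The part of the union missed by the first [n] sets decreases to the empty set, so for large [n]
    its measure is below [e / 2]; the finite union is approximated within the other half. *)
Lemma approximable_bigcup (B : (set X)^nat) :
  (forall k, measurable (B k)) -> (forall k, approximable (B k)) ->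
  approximable (\bigcup_k B k).
Proof.
move=> mB aB e e0; have e20 : 0 < e / 2 by rewrite divr_gt0.
pose F n := \bigcup_(k < n) B k.
have mF n : measurable (F n) by apply: bigcup_measurable => k _; exact: mB.
have mU : measurable (\bigcup_k B k) by apply: bigcup_measurable => k _; exact: mB.
have aF n : approximable (F n).
  elim: n => [|n IH].
    rewrite /F II0 bigcup_set0; apply: (@approximable_determined 0%N) => //.
  suff -> : F n.+1 = F n `|` B n by exact: approximableU.
  apply/seteqP; split => [x [k /= + Bkx]|x [[k /= kn Bkx]|Bnx]].
  - by rewrite ltnS leq_eqVlt => /orP[/eqP <-|kn]; [right|left; exists k].
  - by exists k => //=; exact: ltnW.
  - by exists n => /=.
pose G n := \bigcup_k B k `\` F n.
have mG n : measurable (G n) by exact: measurableD.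
have capG : \bigcap_n G n = set0.
  rewrite -subset0 => x Gx; have [[k _ Bkx] _] := Gx 0%N I.
  by have [_] := Gx k.+1 I; apply; exists k => /=.
have cvgG : mu \o G @ \oo --> mu (\bigcap_n G n).
  apply: nonincreasing_cvg_mu => //.
  - by rewrite -ge0_fin_numE// fin_num_measure.
  - exact: bigcap_measurable.
  - move=> n m nm; apply/subsetPset => x [Ux Fx]; split => // -[k kn Bkx].
    by apply: Fx; exists k => //=; exact: leq_trans kn nm.
have [n muG] : exists n, (mu (G n) < (e / 2)%:E)%E.
  move: cvgG; rewrite capG measure0 => /(_ [set z | (z < (e / 2)%:E)%E]) [].
    by apply: open_nbhs_nbhs; split; [exact: open_ereal_lt_ereal|rewrite /= lte_fin].
  by move=> n _ /(_ n (leqnn n)); exists n.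
have [m [C [dC muC]]] := aF n _ e20.
have mC := measurable_determined_set fw dC.
exists m, C; split => //; rewrite [e]splitr; apply: lt_measureU muG muC => //.
- exact: measurable_setY.
- exact: measurable_setY.
move=> x [[Ux Cx]|[Cx Ux]].
  have [Fx|Fx] := pselect (F n x); first by right; left.
  by left.
by right; right; split => // -[k _ Bkx]; apply: Ux; exists k.
Qed.

(** The measurable approximable sets form a sigma-algebra that contains the open sets. *)
Lemma measurable_approximable B : measurable B -> approximable B.
Proof.
move=> mB; suff [] : [set C : set X | measurable C /\ approximable C] B by [].
apply: (smallest_sub _ _ mB) => [|U oU].
  split.
  - by split => //; apply: (@approximable_determined 0%N).
  - by move=> C [mC aC]; rewrite setTD; split; [exact: measurableC|exact: approximableC].
  - move=> F FP; have mF k : measurable (F k) := (FP k).1.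
    split; first by apply: bigcup_measurable => k _.
    by apply: approximable_bigcup => // k; exact: (FP k).2.
split; first exact: sub_sigma_algebra.
rewrite (open_determined fw oU); apply: approximable_bigcup => n.
  by apply: (measurable_determined_set fw); exact: determined_core_determined.
by apply: approximable_determined; exact: determined_core_determined.
Qed.

Lemma approximate_partition (J : finType) (xi : X -> J) (delta : R) :
  measurable_partition xi -> 0 < delta ->
  exists n (eta : X -> J), determined n eta /\
    \int[mu]_x ((xi x != eta x)%:R : R) <= delta.
Proof.
move=> mxi delta0; pose J0 : R := #|J|%:R.
have J0_gt0 : 0 < J0 by rewrite ltr0n; apply/card_gt0P; exists (xi point).
have /choice[nC nCP] j : exists nC : nat * set X, determined nC.1 nC.2 /\
    (mu (xi @^-1` [set j] `+` nC.2) < (delta / J0)%:E)%E.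
  have e0 : 0 < delta / J0 by exact: divr_gt0.
  have [n [C CP]] := measurable_approximable (mxi j) e0.
  by exists (n, C).
pose N := \max_j (nC j).1.
(* Takes a label whose approximating set contains [x]. If it differs from [xi x], then [x] lies in
   the symmetric difference for the label [xi x] or for the chosen one. *)
pose eta x := if [pick j | `[< (nC j).2 x >]] is Some j then j else xi point.
have deta : determined N eta.
  move=> x y xy; rewrite /eta; congr (if _ is Some _ then _ else _).
  apply: eq_pick => j; congr asbool; apply: (nCP j).1.
  by apply: (agree_le fw _ xy); exact: leq_bigmax.
exists N, eta; split => //.
have mY j : measurable (xi @^-1` [set j] `+` (nC j).2).
  by apply: measurable_setY => //; exact: measurable_determined_set fw _ _ (nCP j).1.
have pointwise x : (xi x != eta x)%:R <=
    \sum_j \1_(xi @^-1` [set j] `+` (nC j).2) x :> R.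
  have [_|xe] := eqVneq (xi x) (eta x).
    by apply: sumr_ge0.
  suff [j jx] : exists j, (xi @^-1` [set j] `+` (nC j).2) x.
    rewrite (bigD1 j)//= [X in _ <= X + _]indicE mem_set// lerDl.
    by apply: sumr_ge0.
  have [Cx|Cx] := pselect ((nC (xi x)).2 x); last by exists (xi x); left.
  move: xe; rewrite /eta; case: pickP => [j /asboolP Cj xj|/(_ (xi x))].
    by exists j; right; split => // /= xij; rewrite xij eqxx in xj.
  by move/asboolPn.
have meta := measurable_determined fw deta.
have bY j := bounded_measurable_indic R (mY j).
apply: (@le_trans _ _ (\int[mu]_x \sum_j \1_(xi @^-1` [set j] `+` (nC j).2) x)).
  apply: le_expectation => //; last exact: bounded_measurable_sum.
  exact: (bounded_measurable_label (measurable_partition_pair mxi meta)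
    (fun ij => (ij.1 != ij.2)%:R)).
rewrite expectation_sum//.
have -> : delta = \sum_(j : J) delta / J0.
  by rewrite sumr_const -mulr_natr divfK// gt_eqF.
apply: ler_sum => j _; rewrite expectation_indic// -lee_fin fineK.
  exact: ltW (nCP j).2.
by rewrite fin_num_measure.
Qed.

(** The delay [r = off n] makes the window readable from the base on; by invariance it does not
    change the error probability. *)
Lemma approximate_itinerary (J : finType) (xi : X -> J) :
  invariant_measure shift_map mu -> measurable_partition xi ->
  forall delta : R, 0 < delta -> exists r q (eta : (nat -> 'I_s) -> J),
    depends_on q eta /\
    \int[mu]_x ((xi (iter r shift_map x) !=
      eta (itinerary shift_map (letter^~ base) x))%:R : R) <= delta.
Proof.
move=> inv mxi delta delta0.
have [n [eta [deta etale]]] := approximate_partition mxi delta0.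
exists (off n), (len n), (eta \o realize hs hA start len n); split.
  exact: depends_on_realize.
apply: le_trans etale; rewrite le_eqVlt; apply/orP; left; apply/eqP.
under eq_Rintegral do rewrite -(determined_itinerary fw _ deta).
have mpair := measurable_partition_pair mxi (measurable_determined fw deta).
exact: (expectation_iter (measurable_shift fw) inv (fun ij => (ij.1 != ij.2)%:R) _ mpair).
Qed.

End approximation.

(** * The Parry measure *)

Lemma sum_wordsS (V : finType) (R : realType) (y : V) k (F : (nat -> V) -> R) :
  depends_on k.+2 F ->
  \sum_(w : {ffun 'I_k.+2 -> V}) F (extend y w) =
  \sum_(z : {ffun 'I_k.+1 -> V}) \sum_i F (cons_word i (extend y z)).
Proof.
move=> Fdep.
pose h (iz : V * {ffun 'I_k.+1 -> V}) : {ffun 'I_k.+2 -> V} :=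
  [ffun j => if unlift ord0 j is Some j' then iz.2 j' else iz.1].
pose h' (w : {ffun 'I_k.+2 -> V}) : V * {ffun 'I_k.+1 -> V} :=
  (w ord0, [ffun j => w (lift ord0 j)]).
have hK : cancel h h'.
  move=> [i z]; rewrite /h /h' ffunE unlift_none/=; congr (_, _).
  by apply/ffunP => j; rewrite !ffunE liftK.
have hK' : cancel h' h.
  by move=> w; apply/ffunP => j; rewrite ffunE; case: unliftP => [j'|] -> /=; rewrite ?ffunE.
rewrite (reindex h) /=; last by exists h' => x _; [exact: hK|exact: hK'].
rewrite exchange_big pair_big/=; apply: eq_big => -[i z]// _; apply: Fdep => n nk.
rewrite -[n]/(val (Ordinal nk)) extendE ffunE.
case: unliftP => [j|] E; last by rewrite E.
have -> : val (Ordinal nk) = j.+1 by rewrite E.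
by rewrite /= extendE.
Qed.

Section parry.
Context (R : realType) (s : nat) (A : 'M[R]_s) (lam : R).
Context (u : 'rV[R]_s) (v : 'cV[R]_s).
Hypothesis h01 : zero_one_mx A.
Hypothesis hperron : perron_data A lam u v.
Local Notation p := (parry_vector u v).
Local Notation P := (parry_matrix A lam v).

Definition word_weight k (w : nat -> 'I_s) : R :=
  p (w 0%N) * \prod_(i < k) P (w i) (w i.+1).

Lemma depends_on_word_weight k : depends_on k.+1 (word_weight k).
Proof.
move=> w w' ww'; rewrite /word_weight ww'//; congr (_ * _).
by apply: eq_bigr => i _; rewrite !ww'// ?ltnS // ltnW.
Qed.

(** Time reversal of the Parry chain: [p i * P i j] equals the backward probability of [i] given
    [j], times [p j]. *)
Lemma word_weight_cons k i w :
  word_weight k.+1 (cons_word i w) =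
  backward_matrix A lam u i (w 0%N) * word_weight k w.
Proof.
rewrite /word_weight big_ord_recl/= !mulrA; congr (_ * _).
have lam0 := lam_gt0 hperron.
have u0 := perron_left_gt0 hperron; have v0 := perron_right_gt0 hperron.
rewrite /parry_vector /parry_matrix /backward_matrix.
by field; rewrite !gt_eqF.
Qed.

(** The ratios of right eigenvector entries telescope; a nonzero weight forces every transition to
    be allowed. *)
Lemma word_weightE k w : word_weight k w != 0 ->
  word_weight k w = u 0 (w 0%N) * v (w k) 0 / lam ^+ k.
Proof.
have lam0 := lam_gt0 hperron; have v0 := perron_right_gt0 hperron.
elim: k => [|k IH]; first by rewrite /word_weight big_ord0 mulr1 divr1.
have -> : word_weight k.+1 w = word_weight k w * P (w k) (w k.+1).
  by rewrite /word_weight big_ord_recr/= mulrA.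
rewrite mulf_eq0 negb_or => /andP[/IH ->]; rewrite /parry_matrix.
case: (h01 (w k) (w k.+1)) => -> ; first by rewrite !mul0r eqxx.
move=> _; have vk := v0 (w k).
by rewrite exprS; field; rewrite !gt_eqF// exprn_gt0.
Qed.

(** Induction on [k]: summing over the first letter turns [g] into its transfer, by time
    reversal. *)
Lemma sum_word_weight (y : 'I_s) k (g : (nat -> 'I_s) -> R) :
  depends_on k.+1 g ->
  \sum_(w : {ffun 'I_k.+1 -> 'I_s}) g (extend y w) * word_weight k (extend y w) =
  parry_mean A lam u v k g.
Proof.
elim: k g => [|k IH] g gdep.
  pose h (i : 'I_s) : {ffun 'I_1 -> 'I_s} := [ffun=> i].
  rewrite (reindex h) /=; last first.
    exists (fun w => w ord0) => [i _|w _]; rewrite ?ffunE//.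
    by apply/ffunP => j; rewrite ffunE (ord1 j).
  rewrite /parry_mean/=; apply: eq_bigr => i _.
  have hE n : (n < 1)%N -> extend y (h i) n = i.
    by case: n => // _; rewrite -[0%N]/(val (@ord0 0)) extendE ffunE.
  rewrite mulrC /word_weight big_ord0 mulr1 hE//; congr (_ * _).
  by apply: gdep => n n1; rewrite hE.
rewrite (@sum_wordsS _ _ y _ (fun w => g w * word_weight k.+1 w)); last first.
  move=> w w' ww'; rewrite (gdep w w')//; congr (_ * _).
  exact: depends_on_word_weight.
rewrite /parry_mean iterSr -/(parry_mean A lam u v k _) -IH; last first.
  exact: depends_on_transfer.
apply: eq_bigr => z _; rewrite mulr_suml; apply: eq_bigr => i _.
by rewrite word_weight_cons mulrCA mulrA.
Qed.

Section measure.
Context (tm : time) (hs : (2 <= s)%N) (hA : aperiodic_mx A).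
Local Notation X := (subshift tm hs hA).
Context (m : probability X R).
Hypothesis hm : parry_measure lam u v m.

Lemma parry_cylinder (y : 'I_s) a k (w : {ffun 'I_k.+1 -> 'I_s}) :
  fine (m ((fun x : X => [ffun i : 'I_k.+1 => word_from a x i]) @^-1` [set w])) =
  word_weight k (extend y w).
Proof.
have -> : (fun x : X => [ffun i : 'I_k.+1 => word_from a x i]) @^-1` [set w] =
    cylinder a k (extend y w).
  apply/seteqP; split => x /=.
    move=> <- i; rewrite -ltnS => ik.
    by rewrite -[i]/(val (Ordinal ik)) extendE ffunE.
  move=> xw; apply/ffunP => i; rewrite ffunE /word_from xw ?extendE//.
  by rewrite -ltnS.
by rewrite hm.
Qed.

Lemma measurable_word_from a k : measurable_partition
  (fun x : X => [ffun i : 'I_k => word_from a x i]).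
Proof. by apply: measurable_partition_ffun => i; exact: measurable_letter. Qed.

Lemma expectation_word_parry a k (g : (nat -> 'I_s) -> R) : depends_on k.+1 g ->
  \int[m]_x g (word_from a x) = parry_mean A lam u v k g.
Proof.
move=> gdep; pose y := letter (point : X) a.
rewrite -(sum_word_weight y gdep).
under eq_bigr do rewrite -(parry_cylinder y a).
rewrite -(expectation_label m (@measurable_word_from a k.+1) (fun w => g (extend y w))).
apply: eq_Rintegral => x _; apply: gdep => i ik.
by rewrite -[i]/(val (Ordinal ik)) extendE ffunE.
Qed.

(** Words of positive mass have [- ln] of their weight equal to [k] times [ln lam], up to a term
    that depends on the two end letters only. *)
Lemma parry_block_entropy a : exists C : R, forall k,
  `|partition_entropy m (join_partition shift_map (letter^~ a : X -> 'I_s) k.+1) -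
    ln lam *+ k| <= C.
Proof.
have lam0 := lam_gt0 hperron.
have u0 := perron_left_gt0 hperron; have v0 := perron_right_gt0 hperron.
pose C := \sum_i \sum_j `|ln (u 0 i * v j 0)|.
exists C => k; pose y := letter (point : X) a.
pose zeta (x : X) := [ffun i : 'I_k.+1 => word_from a x i].
have mzeta : measurable_partition zeta := @measurable_word_from a k.+1.
have -> : join_partition shift_map (letter^~ a : X -> 'I_s) k.+1 = zeta.
  apply/funext => x; apply/ffunP => i; rewrite !ffunE word_from_itinerary.
  by [].
have total := sum_label_probability m mzeta.
rewrite /partition_entropy -[ln lam *+ k]mul1r -total mulr_suml -sumrN -sumrB.
rewrite (le_trans (ler_norm_sum _ _ _))// -[leRHS]mul1r -total mulr_suml.
apply: ler_sum => w _; rewrite (parry_cylinder y).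
set p := word_weight _ _.
have [->|/[dup] p_neq0] := eqVneq p 0; first by rewrite !mul0r oppr0 addr0 normr0.
have p_ge0 : 0 <= p by rewrite /p -(parry_cylinder y a); exact: fine_probability_ge0.
move=> /word_weightE pE; rewrite -mulrN -mulrBr normrM (ger0_norm p_ge0) ler_wpM2l//.
rewrite /p pE ln_div ?posrE ?mulr_gt0 ?exprn_gt0// lnXn// opprB addrAC subrr add0r normrN.
rewrite /C (bigD1 (extend y w 0%N))//= (bigD1 (extend y w k))//= -addrA lerDl.
by rewrite addr_ge0// ?sumr_ge0// => i _; exact: sumr_ge0.
Qed.

(** The partition by a single letter already has entropy [ln lam]. *)
Lemma parry_entropy_ge (a : time_index tm) :
  ((ln lam)%:E <= KS_entropy (@shift_map R s tm A hs hA) m)%E.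
Proof.
apply: ereal_sup_ubound; exists s, (letter^~ a); split; first exact: measurable_letter.
congr EFin; rewrite /entropy_of_partition; set h := fun n => _.
have [C hC] := parry_block_entropy a.
have lnlam : 0 <= ln lam by rewrite ln_ge0// ltW// (perron_gt1 hperron).
suff : h n.+1 @[n --> \oo] --> ln lam by rewrite cvg_shiftS => /cvg_lim ->.
(* The additional [ln lam] arises because a block of [n.+1] letters has only [n] transitions. *)
have bound n : `|h n.+1 - ln lam| <= (C + ln lam) * harmonic n.
  rewrite /h /harmonic /= -[ln lam in X in `|X|](@mulfK _ (n.+1%:R : R))// ?pnatr_eq0//.
  rewrite -mulrBl normrM (ger0_norm (_ : 0 <= n.+1%:R^-1)) ?invr_ge0//.
  rewrite ler_wpM2r ?invr_ge0// mulr_natr mulrS opprD addrCA addrC.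
  by rewrite (le_trans (ler_normB _ _))// (ger0_norm lnlam) lerD2r.
have harm : (C + ln lam) * harmonic n @[n --> \oo] --> (0 : R).
  rewrite -[X in _ --> X](mulr0 (C + ln lam)).
  by apply: cvgM; [exact: cvg_cst|exact: cvg_harmonic].
apply/subr_cvg0; apply/norm_cvg0P.
apply: (squeeze_cvgr _ (cvg_cst 0) harm).
by near=> n; rewrite normr_ge0/= bound.
Unshelve. all: by end_near.
Qed.

End measure.
End parry.

(** * Lipschitz functions *)

Section lipschitz.
Context (R : realType) (s : nat) (tm : time) (A : 'M[R]_s).
Context (hs : (2 <= s)%N) (hA : aperiodic_mx A).
Local Notation X := (subshift tm hs hA).
Context (base : time_index tm) (start : nat -> time_index tm) (len off : nat -> nat).
Hypothesis fw : finite_windows base start len off.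
Context (theta : R) (htheta : 1 < theta).

(** Distinct points differ inside some window, so the levels of agreement are bounded and
    [agreement] is a true maximum rather than its default 0. *)
Lemma agree_agreement n (x y : X) : x <> y -> agree n x y ->
  (n <= agreement x y)%N.
Proof.
move=> xy nxy; rewrite /agreement.
have [i xyi] : exists i, letter x i <> letter y i.
  apply: contrapT => /forallNP xyE; apply: xy; apply: val_inj; apply/funext => i.
  exact: contrapT (xyE i).
have [N Ni] := window_cover fw i.
have agree_ltN k : `[<agree k x y>] -> (k <= N)%N.
  move=> /asboolP kxy; rewrite leqNgt; apply/negP => /ltnW Nk.
  by apply: xyi; apply: (agree_le fw Nk kxy).
have exn : exists k, `[<agree k x y>] by exists n; exact/asboolP.
case: xgetP => [k _ [_]|/(_ (ex_maxn exn agree_ltN))]; first by apply.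
case; case: ex_maxnP => k /asboolP kxy kmax; split => // k' k'xy.
by apply: kmax; exact/asboolP.
Qed.

(** The Lipschitz bound makes both suprema, in [var_n] and in [lip_seminorm], range over bounded
    sets, so that neither takes the default value of [sup]. *)
Lemma lipschitz_agree (f : X -> R) n x y : lipschitz_fun theta f ->
  agree n x y -> `|f x - f y| <= lip_seminorm theta f * theta^-1 ^+ n.
Proof.
move=> [L fL] nxy; have theta0 : 0 < theta by exact: lt_trans htheta.
have fLn k x' y' : agree k x' y' -> `|f x' - f y'| <= `|L| * theta^-1 ^+ k.
  move=> kxy; have [->|xy] := eqVneq x' y'.
    by rewrite subrr normr0 mulr_ge0// exprn_ge0// invr_ge0 ltW.
  apply: (le_trans (fL x' y')); rewrite /shift_dist (negPf xy).
  apply: (@le_trans _ _ (`|L| * theta ^- agreement x' y')).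
    by rewrite ler_wpM2r ?ler_norm// invr_ge0 exprn_ge0// ltW.
  rewrite ler_wpM2l// -exprVn ler_wiXn2l ?invr_ge0 ?(ltW theta0)//.
    by rewrite invf_le1// ltW.
  by apply: agree_agreement kxy; exact/eqP.
have var_ub k : ubound [set r | exists x' y', agree k x' y' /\ r = `|f x' - f y'|]
    (`|L| * theta^-1 ^+ k).
  by move=> _ [x' [y' [kxy ->]]]; exact: fLn.
have var_le k : var_n k f <= `|L| * theta^-1 ^+ k.
  apply: ge_sup (var_ub k); exists 0; exists point, point.
  by rewrite subrr normr0.
have lip_ub : has_ubound [set theta ^+ k * var_n k f | k in [set: nat]].
  exists `|L| => _ [k _ <-].
  rewrite -(ler_pM2l (_ : 0 < theta^-1 ^+ k)); last by rewrite exprn_gt0// invr_gt0.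
  by rewrite mulrA -exprMn mulVf ?gt_eqF// expr1n mul1r mulrC.
apply: (@le_trans _ _ (var_n n f)).
  by apply: ub_le_sup; [exists (`|L| * theta^-1 ^+ n)|exists x, y].
rewrite exprVn ler_pdivlMr ?exprn_gt0// mulrC.
by apply: ub_le_sup => //; exists n.
Qed.

Section function.
Context (f : X -> R) (hf : lipschitz_fun theta f).
Local Notation rho := theta^-1.
Local Notation Lf := (lip_seminorm theta f).

Lemma lip_seminorm_ge0 : 0 <= Lf.
Proof.
have := lipschitz_agree hf (@agree_refl _ _ _ _ hs hA 0 point).
by rewrite subrr normr0 expr0 mulr1.
Qed.

Lemma lipschitz_canonical n x : `|f x - f (canonical n x)| <= Lf * rho ^+ n.
Proof. by apply: lipschitz_agree => //; exact: agree_canonical. Qed.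

Lemma determined_step n : determined n.+1
  (fun x : X => f (canonical n.+1 x) - f (canonical n x)).
Proof.
move=> x y xy; rewrite (determined_canonical xy) (determined_canonical (n := n) (y := y))//.
exact: (agree_le fw (leqnSn n) xy).
Qed.

Lemma norm_step_le n (x : X) :
  `|f (canonical n.+1 x) - f (canonical n x)| <= Lf * rho ^+ n.
Proof.
apply: lipschitz_agree => //; apply: (@agree_trans _ _ _ _ _ _ _ _ x).
  by apply/agree_sym/(agree_le fw (leqnSn n)); exact: agree_canonical.
exact: agree_canonical.
Qed.

Lemma bounded_measurable_canonical n :
  bounded_measurable (fun x : X => f (canonical n x)).
Proof.
by apply: (bounded_measurable_determined fw (n := n)) => x y /determined_canonical ->.
Qed.

Lemma rho_gt0 : 0 < rho. Proof. by rewrite invr_gt0 (lt_trans _ htheta). Qed.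

Lemma rho_lt1 : rho < 1. Proof. by rewrite invf_lt1// (lt_trans _ htheta). Qed.

Lemma cvg_lipschitz_error (c : R) : c * rho ^+ n @[n --> \oo] --> 0.
Proof.
rewrite -[X in _ --> X](mulr0 c); apply: cvgM; first exact: cvg_cst.
by apply: cvg_expr; rewrite gtr0_norm ?rho_gt0 ?rho_lt1.
Qed.

Lemma bounded_measurable_lipschitz : bounded_measurable f.
Proof.
split.
  apply: (@measurable_fun_cvg _ _ _ _ (fun n x => f (canonical n x))) => [n|x _].
    exact: (bounded_measurable_canonical n).1.
  apply/subr_cvg0/norm_cvg0P.
  apply: (squeeze_cvgr _ (cvg_cst 0) (cvg_lipschitz_error Lf)).
  by near=> n; rewrite normr_ge0/= distrC lipschitz_canonical.
exists (`|f point| + Lf) => x; rewrite -[f x](subrK (f point)) addrC.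
rewrite (le_trans (ler_normD _ _))// lerD2l.
(* The window of level 0 is empty, since [len 0 <= 0]; any two points therefore agree at level 0. *)
by rewrite -[leRHS]mulr1 -(expr0 rho); apply: lipschitz_agree => // i /(windowP fw)[k];
  have := len_le fw 0; case: (len 0).
Unshelve. all: by end_near.
Qed.

Lemma canonical0 (x y : X) : f (canonical 0 x) = f (canonical 0 y).
Proof.
congr f; apply: determined_canonical => i /(windowP fw)[k].
by have := len_le fw 0; case: (len 0).
Qed.

Lemma expectation_canonical_error (P : probability X R) n :
  `|\int[P]_x f x - \int[P]_x f (canonical n x)| <= Lf * rho ^+ n.
Proof.
rewrite -expectationB; [|exact: bounded_measurable_lipschitz|exact: bounded_measurable_canonical].
apply: norm_expectation_le; last exact: lipschitz_canonical.
apply: bounded_measurableB; first exact: bounded_measurable_lipschitz.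
exact: bounded_measurable_canonical.
Qed.

Lemma expectation_telescope (P : probability X R) r :
  \int[P]_x f (canonical r x) = f (canonical 0 point) +
  \sum_(n < r) \int[P]_x (f (canonical n.+1 x) - f (canonical n x)).
Proof.
elim: r => [|r IH].
  rewrite big_ord0 addr0 -[RHS](expectation_cst P).
  by apply: eq_Rintegral => x _; exact: canonical0.
rewrite big_ord_recr/= addrA -IH expectationB; last 2 first.
- exact: bounded_measurable_canonical.
- exact: bounded_measurable_canonical.
by rewrite addrC subrK.
Qed.

End function.

Lemma expectation_determined_iter (mu : probability X R) n (psi : X -> R) r :
  invariant_measure shift_map mu -> determined n psi ->
  \int[mu]_x psi (iter r shift_map x) = \int[mu]_x psi x.
Proof.
move=> inv dpsi; have := determined_label fw dpsi.
set phi := fun w : {ffun _ -> _} => _; set zeta := (X in _ \o X) => psiE.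
have mzeta : measurable_partition zeta by exact: measurable_word.
by have := expectation_iter (measurable_shift fw) inv phi r mzeta; rewrite psiE.
Qed.

Lemma weighted_geometric_bound (C : R) : 0 <= C -> exists2 c : R, 0 < c &
  forall r, \sum_(n < r) ((n.*2.+1)%:R + C) * theta^-1 ^+ n <= c.
Proof.
move=> C0; have rho0 := rho_gt0; have rho1 := rho_lt1.
pose rho := theta^-1; rewrite -/rho in rho0 rho1 *.
have d0 : 0 < 1 - rho by rewrite subr_gt0.
(* Chosen so that [b - (a * r%:R + b) * rho ^+ r] has increments [((r.*2.+1)%:R + C) * rho ^+ r] and
   vanishes at 0. *)
pose a := 2 / (1 - rho); pose b := (1 + C + a * rho) / (1 - rho).
have a0 : 0 < a by rewrite divr_gt0.
have b0 : 0 < b by apply: divr_gt0 => //; have := mulr_gt0 a0 rho0; lra.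
exists b => // r.
suff -> : \sum_(n < r) ((n.*2.+1)%:R + C) * rho ^+ n = b - (a * r%:R + b) * rho ^+ r.
  by rewrite gerBl mulr_ge0 ?exprn_ge0 ?(ltW rho0)// addr_ge0 ?(ltW b0)// mulr_ge0 ?(ltW a0).
elim: r => [|r IH]; first by rewrite big_ord0 mulr0 add0r expr0 mulr1 subrr.
rewrite big_ord_recr/= IH exprS -[r.+1%:R]natr1 -[(r.*2.+1)%:R]natr1 -muln2 natrM /b /a.
by field; rewrite gt_eqF.
Qed.

End lipschitz.

(** * From the entropy deficit to the deviation inequality *)

Section effective_uniqueness.
Context (R : realType) (s : nat) (A : 'M[R]_s) (theta lam : R).
Context (u : 'rV[R]_s) (v : 'cV[R]_s) (hs : (2 <= s)%N).
Hypotheses (h01 : zero_one_mx A) (hirr : irreducible_mx A) (hA : aperiodic_mx A).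
Hypotheses (htheta : 1 < theta) (hperron : perron_data A lam u v).
Context (tm : time) (base : time_index tm) (start : nat -> time_index tm).
Context (len off : nat -> nat).
Hypothesis fw : finite_windows base start len off.
Local Notation X := (subshift tm hs hA).
Local Notation itin := (itinerary shift_map (letter^~ base : X -> 'I_s)).
Local Notation trans := (transfer A lam u).

Lemma admissible_base (x : X) : A (letter x base) (letter (shift_map x) base) = 1.
Proof. by have := svalP x; rewrite inE; apply. Qed.

Lemma depends_on_sum (V : Type) (I : Type) (r : seq I) q
    (g : I -> (nat -> V) -> R) :
  (forall i, depends_on q (g i)) -> depends_on q (fun w => \sum_(i <- r) g i w).
Proof. by move=> gq w w' ww'; apply: eq_bigr => i _; exact: gq. Qed.

(** The deficit bound is applied to the sum of the Poisson solutions of the first [r] increments of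
    [f]. Geometric decay beats the linear growth in the number of letters, so [c] is independent of
    [r]. *)
Lemma entropy_gap : exists2 c : R, 0 < c &
  forall (m mu : probability X R) (f : X -> R) r,
    parry_measure lam u v m -> invariant_measure shift_map mu ->
    lipschitz_fun theta f -> 0 < lip_seminorm theta f ->
    (KS_entropy (@shift_map R s tm A hs hA) mu <= (ln lam -
      (\int[mu]_x f (canonical r x) - \int[m]_x f (canonical r x)) ^+ 2 /
      (32 * (c * lip_seminorm theta f) ^+ 2))%:E)%E.
Proof.
have [C C0 poissonC] := poisson_word h01 hirr hperron.
have [c c0 csum] := weighted_geometric_bound htheta C0.
exists c => // m mu f r hm inv hf Lf0.
set L := lip_seminorm theta f in Lf0 *; pose rho := theta^-1.
pose psi n (x : X) := f (canonical n.+1 x) - f (canonical n x).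
have dpsi n : determined n.+1 (psi n) by exact: (determined_step fw).
pose g n := psi n \o realize hs hA start len n.+1.
(* The window of level [n.+1] has at most [2 (n + 1)] letters, hence the index [n.*2.+1] in the
   Poisson equation. *)
have gdep n : depends_on (n.*2.+1).+1 (g n).
  apply: (@depends_onW _ _ (len n.+1)); first exact: len_le fw n.+1.
  exact: depends_on_realize.
have gL n w : `|g n w| <= L * rho ^+ n by exact: (norm_step_le fw htheta hf).
have /choice[G GP] n := poissonC n.*2.+1 (g n) _ (gdep n) (gL n).
pose kappa n := parry_mean A lam u v n.*2.+1 (g n).
(* Cylinder probabilities of the Parry measure do not depend on the starting index, so the word may
   be read from the start of its window. *)
have kappaE n : kappa n = \int[m]_x psi n x.
  rewrite /kappa -(expectation_word_parry hperron hm (start n.+1) (gdep n)).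
  by apply: eq_Rintegral => x _; rewrite /g /= (determined_realize fw x (dpsi n)).
have mS : measurable_fun setT (@shift_map R s tm A hs hA) by exact: measurable_shift fw.
have mbase : measurable_partition (letter^~ base : X -> 'I_s) by exact: measurable_letter.
have gE n : \int[mu]_x g n (itin x) = \int[mu]_x psi n x.
  rewrite -(expectation_determined_iter fw (off n.+1) inv (dpsi n)).
  by apply: eq_Rintegral => x _; rewrite (determined_itinerary fw _ (dpsi n)).
pose Gr w := \sum_(n < r) G n w.
have Grdep : depends_on (r.*2.+1).+1 Gr.
  apply: depends_on_sum => n; have [+ _ _] := GP n; apply: depends_onW.
  by rewrite !ltnS leq_double ltnW.
have GrB w : `|Gr w| <= c * L.
  rewrite (le_trans (ler_norm_sum _ _ _))//.
  apply: (@le_trans _ _ (L * \sum_(n < r) ((n.*2.+1)%:R + C) * rho ^+ n)).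
    rewrite mulr_sumr; apply: ler_sum => n _; have [_ + _] := GP n.
    by rewrite [in leRHS]mulrCA.
  by rewrite mulrC ler_wpM2r// ltW.
have bG := bounded_measurable_itinerary mS mbase Grdep.
have Grdep2 : depends_on (r.*2.+1).+2 Gr by exact: depends_onW Grdep.
have bLG := bounded_measurable_itinerary mS mbase (depends_on_transfer A lam u Grdep2).
(* By the Poisson equations the left side is the sum of the deviations of the increments; it
   telescopes, the level 0 value being a constant common to both measures. *)
have devE : \int[mu]_x Gr (itin x) - \int[mu]_x trans Gr (itin x) =
    \int[mu]_x f (canonical r x) - \int[m]_x f (canonical r x).
  rewrite -expectationB// !(expectation_telescope fw f) addrAC opprD addrA.
  rewrite subrr add0r addrC -sumrB.
  under eq_Rintegral => x _.
    rewrite /Gr transfer_sum -sumrB.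
    under eq_bigr => n _.
      have [_ _ ->] := GP n; over.
    over.
  have bg n : bounded_measurable (fun x => g n (itin x)).
    exact: (bounded_measurable_itinerary mS mbase (gdep n)).
  rewrite expectation_sum => [|n]; last first.
    by apply: bounded_measurableB => //; exact: bounded_measurable_cst.
  apply: eq_bigr => n _; rewrite expectationB ?expectation_cst//; last first.
    exact: bounded_measurable_cst.
  by rewrite gE -/(kappa n) kappaE.
apply: ge_ereal_sup => _ [k [xi [mxi ->]]]; rewrite lee_fin -devE.
apply: (entropy_deficit h01 hperron mS inv mbase admissible_base Grdep) => //.
  exact: mulr_gt0.
exact: (approximate_itinerary fw inv mxi).
Qed.

Lemma KS_entropy_neqNy (mu : probability X R) :
  KS_entropy (@shift_map R s tm A hs hA) mu != -oo%E.
Proof.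
rewrite -ltNye; apply: (@lt_le_trans _ _
  (entropy_of_partition shift_map mu (letter^~ base : X -> 'I_s))%:E).
  exact: ltNyr.
apply: ereal_sup_ubound; exists s, (letter^~ base).
by split; first exact: measurable_letter.
Qed.

(** Solving the gap inequality for the deviation gives the factor [Num.sqrt 32]; then [r] tends to
    infinity and [ln lam] is replaced by the possibly larger entropy of [m]. *)
Lemma parry_deviation (m : probability X R) : parry_measure lam u v m ->
  exists c : R, 0 < c /\
    forall (mu : probability X R) (f : X -> R),
      invariant_measure shift_map mu ->
      lipschitz_fun theta f ->
      (`| \int[mu]_x f x - \int[m]_x f x |%:E <=
        (c * lip_seminorm theta f)%:E *
        sqrte (KS_entropy shift_map m - KS_entropy shift_map mu))%E.
Proof.
move=> hm; have [c c0 gap] := entropy_gap.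
exists (Num.sqrt 32 * c); split; first by rewrite mulr_gt0// sqrtr_gt0.
move=> mu f inv hf; set L := lip_seminorm theta f; set Y := _ - _.
have L0 : 0 <= L by exact: (lip_seminorm_ge0 fw htheta hf).
pose Yr r := \int[mu]_x f (canonical r x) - \int[m]_x f (canonical r x).
have YYr r : `|Y| <= `|Yr r| + 2 * L * theta^-1 ^+ r.
  have -> : Y = Yr r + ((\int[mu]_x f x - \int[mu]_x f (canonical r x)) -
      (\int[m]_x f x - \int[m]_x f (canonical r x))) by rewrite /Y /Yr; ring.
  rewrite (le_trans (ler_normD _ _))// lerD2l (le_trans (ler_normB _ _))//.
  rewrite -mulrA mulr_natl mulr2n.
  by apply: lerD; exact: (expectation_canonical_error fw htheta hf).
(* The gap inequality requires a positive seminorm. If it is 0, both sides vanish, whatever the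
   entropies are. *)
have [L_eq0|L_neq0] := eqVneq L 0.
  rewrite L_eq0 mulr0 mul0e lee_fin (le_trans (YYr 0%N))// L_eq0 mulr0 mul0r addr0.
  by rewrite /Yr !(expectation_telescope fw f) !big_ord0 subrr normr0.
have {L_neq0}L_gt0 : 0 < L by rewrite lt0r L_neq0.
have gapr r := gap m mu f r hm inv hf L_gt0; rewrite -/L in gapr.
have : KS_entropy (@shift_map R s tm A hs hA) mu \is a fin_num.
  by rewrite fin_numE KS_entropy_neqNy lt_eqF// (le_lt_trans (gapr 0%N))// ltry.
move=> /fineK; set h := fine _ => hE; rewrite -hE in gapr *.
have d_ge0 : 0 <= ln lam - h.
  have := gapr 0%N; rewrite lee_fin => /le_trans hle; rewrite subr_ge0.
  by apply: hle; rewrite gerBl divr_ge0 ?sqr_ge0// mulr_ge0 ?sqr_ge0.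
have bound r : `|Yr r| <= Num.sqrt 32 * c * L * Num.sqrt (ln lam - h).
  have := gapr r; rewrite -/(Yr r) lee_fin lerBrDr -lerBrDl => Yle.
  have cL0 : 0 < c * L by exact: mulr_gt0.
  rewrite -ler_sqr ?nnegrE ?mulr_ge0 ?sqrtr_ge0 ?(ltW c0)//.
  rewrite real_normK ?num_real// -mulrA 3!exprMn !sqr_sqrtr//.
  rewrite ler_pdivrMr ?mulr_gt0 ?exprn_gt0// in Yle.
  by rewrite (le_trans Yle)// le_eqVlt; apply/orP; left; apply/eqP; ring.
have Yle : `|Y| <= Num.sqrt 32 * c * L * Num.sqrt (ln lam - h).
  have := cvg_lipschitz_error htheta (2 * L).
  move=> /(cvgD (cvg_cst (Num.sqrt 32 * c * L * Num.sqrt (ln lam - h)))).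
  rewrite addr0 => lim; apply: (ler_cvg_to (cvg_cst _) lim).
  by near=> r; rewrite (le_trans (YYr r))// lerD2r bound.
apply: (@le_trans _ _ ((Num.sqrt 32 * c * L)%:E * sqrte (ln lam - h)%:E)%E).
  by rewrite /= -EFinM lee_fin.
apply: lee_wpmul2l; first by rewrite lee_fin !mulr_ge0 ?sqrtr_ge0// ltW.
have hle : ((ln lam - h)%:E <= KS_entropy (@shift_map R s tm A hs hA) m - h%:E)%E.
  by rewrite EFinB leeB//; exact: (parry_entropy_ge h01 hperron hm base).
by rewrite lee_sqrt// (le_trans _ hle)// lee_fin.
Unshelve. all: by end_near.
Qed.

End effective_uniqueness.

(** * Windows of the one-sided and two-sided shifts *)

Lemma one_sided_windows :
  @finite_windows one_sided 0%N (fun=> 0%N) id (fun=> 0%N).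
Proof.
have iterS0 k : iter k (@succ_index one_sided) 0%N = k :> nat by elim: k => //= k ->.
split => //.
- move=> n i /=; split => [iN|[k kn ->]]; last by rewrite iterS0.
  by exists i; rewrite ?iterS0.
- by move=> n i /= /ltnW.
- by move=> i; exists i.+1 => /=.
- by move=> n; rewrite -addnn leq_addr.
Qed.

(** The window of level [n >= 1] is the interval from [-(n - 1)] to [n - 1]; at [n = 0] the
    truncated predecessor gives length 0, as it should. *)
Lemma two_sided_windows :
  @finite_windows two_sided (0 : int) (fun n => - (n.-1)%:Z)
    (fun n => n.*2.-1) predn.
Proof.
have iterE k (a : int) : iter k (@succ_index two_sided) a = a + k%:Z.
  by elim: k => [|k /= ->]; [rewrite addr0|rewrite -addrA -PoszD addn1].
split.
- have windowE (i : int) n : (`|i| < n)%N <->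
      exists2 k, (k < n.*2.-1)%N & i = - (n.-1)%:Z + k%:Z.
    split => [iN|[k kn ->]]; last lia.
    by exists (absz (i + (n.-1)%:Z)); lia.
  move=> n i; split => [/windowE[k kn ->]|[k kn ->]]; first by exists k; rewrite ?iterE.
  by apply/windowE; exists k; rewrite ?iterE.
- by move=> n; rewrite iterE addNr.
- by move=> n i /= /ltnW.
- by move=> n; suff H (i : int) : (`|i| < n)%N -> (absz (i + 1)%R < n.+1)%N by []; lia.
- by move=> i; exists (absz i).+1 => /=.
- by move=> n; exact: leq_pred.
Qed.

Theorem theorem1p1 (R : realType) (s : nat) (A : 'M[R]_s) (theta : R)
    (lam : R) (u : 'rV[R]_s) (v : 'cV[R]_s)
    (hs : (2 <= s)%N) (h01 : zero_one_mx A) (hirr : irreducible_mx A)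
    (hA : aperiodic_mx A) (htheta : 1 < theta)
    (hperron : perron_data A lam u v) :
  (forall m : probability (subshift one_sided hs hA) R,
    parry_measure lam u v m ->
    exists c : R, 0 < c /\
      forall (mu : probability (subshift one_sided hs hA) R)
             (f : subshift one_sided hs hA -> R),
        invariant_measure shift_map mu ->
        lipschitz_fun theta f ->
        (`| \int[mu]_x f x - \int[m]_x f x |%:E <=
          (c * lip_seminorm theta f)%:E *
          sqrte (KS_entropy shift_map m - KS_entropy shift_map mu))%E)
  /\
  (forall m : probability (subshift two_sided hs hA) R,
    parry_measure lam u v m ->
    exists c : R, 0 < c /\
      forall (mu : probability (subshift two_sided hs hA) R)
             (f : subshift two_sided hs hA -> R),
        invariant_measure shift_map mu ->
        lipschitz_fun theta f ->
        (`| \int[mu]_x f x - \int[m]_x f x |%:E <=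
          (c * lip_seminorm theta f)%:E *
          sqrte (KS_entropy shift_map m - KS_entropy shift_map mu))%E).
Proof.
split=> m hm.
- exact: (parry_deviation h01 hirr htheta hperron one_sided_windows hm).
- exact: (parry_deviation h01 hirr htheta hperron two_sided_windows hm).
Qed.
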